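(* Let $\mathcal{P}, \mathcal{Q} \in \mathcal{S}_\alpha^{\mathbf{k}}$ be rank-$1$ tensors. If $p = (\lambda, \mathbf{u}_1, \ldots, \mathbf{u}_d) \in \otimes^{-1}(\mathcal{P})$ and $q = (\mu, \mathbf{v}_1, \ldots, \mathbf{v}_d) \in \otimes^{-1}(\mathcal{Q})$ are matched, $\alpha$-compatible representatives with $\mathbf{u}_i\neq-\mathbf{v}_i$ for all $i=1,\dots,d$, then $$\log_{\mathcal{P}} \mathcal{Q} = (\mathrm{d}_{p} \otimes)(\log_p q),$$ where $\mathrm{d}_p\otimes: \mathrm{T}_{p} \mathcal{P}_\alpha^{\mathbf{k}} \to \mathrm{T}_{\mathcal{P}} \mathcal{S}_\alpha^{\mathbf{k}}$ is the differential of $\otimes$ at $p$.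
   Context: Let $d\ge 1$, let $n_1,\dots,n_d$ and $k_1,\dots,k_d$ be positive integers, $\mathbf{k}=(k_1,\dots,k_d)$, and $\alpha>0$. $\mathbb{S}^{n-1}\subset\mathbb{R}^n$ is the unit sphere, $\langle\cdot,\cdot\rangle$ the Euclidean inner product, and $\sphericalangle(\mathbf{u},\mathbf{v})=\arccos\langle\mathbf{u},\mathbf{v}\rangle\in[0,\pi]$ for unit vectors. The $\alpha$-warped pre-Segre--Veronese manifold $\mathcal{P}_\alpha^{\mathbf{k}}$ is $\mathbb{R}_{>0}\times\mathbb{S}^{n_1-1}\times\cdots\times\mathbb{S}^{n_d-1}$ with the Riemannian metric $$g_{(\lambda,\mathbf{u}_1,\ldots,\mathbf{u}_d)}\bigl((\dot{x}, \dot{\mathbf{u}}_1, \ldots, \dot{\mathbf{u}}_d),(\dot{y}, \dot{\mathbf{v}}_1, \ldots, \dot{\mathbf{v}}_d)\bigr)=\dot{x} \dot{y} + (\alpha\lambda)^2 \sum_{i=1}^d k_i \langle \dot{\mathbf{u}}_i, \dot{\mathbf{v}}_i \rangle .$$ The $\alpha$-warped Segre--Veronese manifold $\mathcal{S}_\alpha^{\mathbf{k}}$ is the submanifold $\{\lambda\mathbf{u}_1^{\otimes k_1}\otimes\cdots\otimes\mathbf{u}_d^{\otimes k_d}\mid\lambda>0,\ \mathbf{u}_i\in\mathbb{S}^{n_i-1}\}$ of $\mathbb{R}^{n_1^{k_1}\times\cdots\times n_d^{k_d}}\setminus\{0\}$, with the metric induced from the ambient metric $\varsigma^\alpha_{\lambda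 \mathcal{W}}(\dot{x}\,\mathcal{W}+\lambda\dot{\mathcal{V}},\dot{y}\,\mathcal{W}+\lambda\dot{\mathcal{V}}')=\dot{x}\dot{y}+(\alpha\lambda)^2\langle\dot{\mathcal{V}},\dot{\mathcal{V}}'\rangle$, where $\lambda>0$, $\|\mathcal{W}\|=1$, $\dot{\mathcal{V}},\dot{\mathcal{V}}'\perp\mathcal{W}$. The map $\otimes:\mathcal{P}_\alpha^{\mathbf{k}}\to\mathcal{S}_\alpha^{\mathbf{k}}$ is $(\lambda,\mathbf{u}_1,\dots,\mathbf{u}_d)\mapsto\lambda\mathbf{u}_1^{\otimes k_1}\otimes\cdots\otimes\mathbf{u}_d^{\otimes k_d}$; elements of $\otimes^{-1}(\mathcal{P})$ are representatives of $\mathcal{P}$. For $p=(\lambda,\mathbf{u}_1,\dots,\mathbf{u}_d)$, $q=(\mu,\mathbf{v}_1,\dots,\mathbf{v}_d)$ in $\mathcal{P}_\alpha^{\mathbf{k}}$ put $M(p,q)=\sqrt{\sum_{i=1}^d k_i\,\sphericalangle^2(\mathbf{u}_i,\mathbf{v}_i)}$. They are $\alpha$-compatible if $M(p,q)<\pi/\alpha$. Representatives $p^\star\in\otimes^{-1}(\mathcal{P})$, $q^\star\in\otimes^{-1}(\mathcal{Q})$ are matched if $(p^\star,q^\star)$ minimizes $M(p,q)$ over $p\in\otimes^{-1}(\mathcal{P})$, $q\in\otimes^{-1}(\mathcal{Q})$. A minimizing geodesic is a curve whose length equals the intrinsic distance between its endpoints. The logarithm $\log_x y$ is the initial velocity at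 $x$ of a constant-speed minimizing geodesic $\gamma:[0,1]\to\mathcal{M}$ with $\gamma(0)=x$, $\gamma(1)=y$ (so $\exp_x(\log_x y)=y$); if $\mathcal{P},\mathcal{Q}$ are joined by several minimizing geodesics, the statement is that the right-hand side is the initial velocity of one of them. Explicitly, in $\mathcal{P}_\alpha^{\mathbf{k}}$, with $M=M(p,q)$ and $\mathbf{u}_i\ne-\mathbf{v}_i$ for all $i$, $\log_p(q)=(\mu\cos(\alpha M)-\lambda,\dot{\mathbf{u}}_1,\dots,\dot{\mathbf{u}}_d)$ with $\dot{\mathbf{u}}_i=\frac{\mu\sin(\alpha M)}{\lambda\alpha M}\log^{\mathbb{S}}_{\mathbf{u}_i}(\mathbf{v}_i)$ (and $\log_p(q)=(\mu-\lambda,0,\dots,0)$ if $M=0$), where $\log^{\mathbb{S}}_{\mathbf{u}}(\mathbf{v})=(\mathbf{v}-\langle\mathbf{v},\mathbf{u}\rangle\mathbf{u})\frac{\sphericalangle(\mathbf{u},\mathbf{v})}{\sin\sphericalangle(\mathbf{u},\mathbf{v})}$ (and $0$ if $\mathbf{u}=\mathbf{v}$). *)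

(* Defs.v *)
From HB Require Import structures.
From mathcomp Require Import all_boot all_order all_algebra.
From mathcomp Require Import all_classical all_reals all_analysis.

Set Implicit Arguments.
Unset Strict Implicit.
Unset Printing Implicit Defensive.

Import Order.TTheory GRing.Theory Num.Theory.
Import numFieldNormedType.Exports.

Local Open Scope classical_set_scope.
Local Open Scope ring_scope.

(** * Length, distance and logarithm on a Riemannian submanifold

   A submanifold of a normed space [V] is given by its underlying set [X], and
   its Riemannian metric by [g x v w], the inner product at [x] of the tangent
   vectors [v] and [w]; only tangent arguments matter. *)

(* C^1 on the closed interval [a, b], in the sense of one-sided derivatives at
   the end points: this is the same as having a C^1 extension to the line. *)
Definition C1_on (R : realType) (V : normedModType R) (a b : R) (c : R -> V) :=
  exists e : R -> V, [/\ forall t, derivable e t 1, continuous (derive1 e) &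
    forall t, a <= t <= b -> c t = e t].

(* The closed pieces overlap at the break points, so that [c] is continuous. *)
Definition piecewise_C1 (R : realType) (V : normedModType R) (a b : R)
    (c : R -> V) :=
  exists s : seq R, itv_partition a b s /\
    forall j, (j < size s)%N -> C1_on (nth b (a :: s) j) (nth b s j) c.

Definition joins (R : realType) (V : normedModType R) (X : set V) (x y : V)
    (c : R -> V) :=
  [/\ forall t, 0 <= t <= 1 -> X (c t), c 0 = x & c 1 = y].

Definition speed (R : realType) (V : normedModType R) (g : V -> V -> V -> R)
    (c : R -> V) (t : R) : R :=
  Num.sqrt (g (c t) (derive1 c t) (derive1 c t)).

(* [derive1 c] is meaningless at 0, 1 and the break points, a negligible set. *)
Definition curve_length (R : realType) (V : normedModType R)
    (g : V -> V -> V -> R) (c : R -> V) : \bar R :=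
  (\int[lebesgue_measure]_(t in `[0%R, 1%R]) (speed g c t)%:E)%E.

(* This is [+oo] when no curve joins the two points. *)
Definition intrinsic_dist (R : realType) (V : normedModType R) (X : set V)
    (g : V -> V -> V -> R) (x y : V) : \bar R :=
  ereal_inf [set curve_length g c | c in
    [set c : R -> V | piecewise_C1 0 1 c /\ joins X x y c]].

Definition minimizing_geodesic (R : realType) (V : normedModType R) (X : set V)
    (g : V -> V -> V -> R) (x y : V) (c : R -> V) :=
  [/\ C1_on 0 1 c, joins X x y c,
      exists s : R, forall t, 0 < t < 1 -> speed g c t = s &
      curve_length g c = intrinsic_dist X g x y].

Definition initial_velocity (R : realType) (V : normedModType R) (c : R -> V)
    (v : V) :=
  h^-1 *: (c h - c 0) @[h --> 0^'+] --> v.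

(* A relation, since several minimizing geodesics may join [x] to [y]. *)
Definition is_log (R : realType) (V : normedModType R) (X : set V)
    (g : V -> V -> V -> R) (x y v : V) :=
  exists c : R -> V, minimizing_geodesic X g x y c /\ initial_velocity c v.

(** * Euclidean geometry; the library norm on row vectors is the sup norm *)

Definition dot (R : realType) (m : nat) (u v : 'rV[R]_m) : R :=
  \sum_(j < m) u 0 j * v 0 j.

Definition enorm (R : realType) (m : nat) (u : 'rV[R]_m) : R :=
  Num.sqrt (dot u u).

Definition angle (R : realType) (m : nat) (u v : 'rV[R]_m) : R :=
  acos (dot u v).

Definition sphere_log (R : realType) (m : nat) (u v : 'rV[R]_m) : 'rV[R]_m :=
  if u == v then 0
  else (angle u v / sin (angle u v)) *: (v - dot v u *: u).

(** * The warped pre-Segre--Veronese manifold *)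

(* R x R^(n_1) x ... x R^(n_d), with all the vectors concatenated in one row. *)
Definition pre_space (R : realType) (d : nat) (n : 'I_d -> nat)
    : normedModType R :=
  (R^o * 'rV[R]_(\sum_i n i))%type.

Definition radius (R : realType) (d : nat) (n : 'I_d -> nat)
    (p : pre_space R n) : R := p.1.

Definition part (R : realType) (d : nat) (n : 'I_d -> nat)
    (p : pre_space R n) (i : 'I_d) : 'rV[R]_(n i) := submxrow p.2 i.

Definition pre_segre_veronese (R : realType) (d : nat) (n : 'I_d -> nat)
    : set (pre_space R n) :=
  [set p | 0 < radius p /\ forall i, enorm (part p i) = 1].

Definition pre_metric (R : realType) (d : nat) (n k : 'I_d -> nat) (alpha : R)
    (p x y : pre_space R n) : R :=
  radius x * radius y +
  (alpha * radius p) ^+ 2 * \sum_i (k i)%:R * dot (part x i) (part y i).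

Definition Mdist (R : realType) (d : nat) (n k : 'I_d -> nat)
    (p q : pre_space R n) : R :=
  Num.sqrt (\sum_i (k i)%:R * angle (part p i) (part q i) ^+ 2).

Definition compatible (R : realType) (d : nat) (n k : 'I_d -> nat) (alpha : R)
    (p q : pre_space R n) :=
  Mdist k p q < pi / alpha.

Definition pre_log (R : realType) (d : nat) (n k : 'I_d -> nat) (alpha : R)
    (p q : pre_space R n) : pre_space R n :=
  let lambda := radius p in
  let mu := radius q in
  let M := Mdist k p q in
  if M == 0 then (mu - lambda, 0)
  else (mu * cos (alpha * M) - lambda,
        \mxrow_i ((mu * sin (alpha * M) / (lambda * alpha * M)) *:
                  sphere_log (part p i) (part q i))).

(** * The warped Segre--Veronese manifold *)

(* [J i l] is the position along the [l]-th of the [k i] modes of size [n i]. *)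
Definition multi_index (d : nat) (n k : 'I_d -> nat) : finType :=
  {dffun forall i : 'I_d, {ffun 'I_(k i) -> 'I_(n i)}}.

(* Tensors are rows of entries, listed along the enumeration of the indices. *)
Definition tensor (R : realType) (d : nat) (n k : 'I_d -> nat)
    : normedModType R :=
  'rV[R]_#|multi_index n k|.

(* lambda u_1^(k_1) (x) ... (x) u_d^(k_d), on the whole linear space *)
Definition otimes (R : realType) (d : nat) (n k : 'I_d -> nat)
    (p : pre_space R n) : tensor R n k :=
  \row_j (radius p *
    \prod_(i < d) \prod_(l < k i)
      part p i 0 ((enum_val j : multi_index n k) i l)).

Definition segre_veronese (R : realType) (d : nat) (n k : 'I_d -> nat)
    : set (tensor R n k) :=
  [set otimes k p | p in @pre_segre_veronese R d n].

(* At [A = lambda W] with [lambda > 0] and [|W| = 1], a vector [T] is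
   [x W + lambda V] with [x = <T, W>] and [V] orthogonal to [W]. *)
Definition warped_metric (R : realType) (m : nat) (alpha : R)
    (A T T' : 'rV[R]_m) : R :=
  let lambda := enorm A in
  let W := lambda^-1 *: A in
  let x (S : 'rV[R]_m) := dot S W in
  let V (S : 'rV[R]_m) := lambda^-1 *: (S - x S *: W) in
  x T * x T' + (alpha * lambda) ^+ 2 * dot (V T) (V T').

Definition representative (R : realType) (d : nat) (n k : 'I_d -> nat)
    (P : tensor R n k) (p : pre_space R n) :=
  pre_segre_veronese p /\ otimes k p = P.

Definition matched (R : realType) (d : nat) (n k : 'I_d -> nat)
    (P Q : tensor R n k) (p q : pre_space R n) :=
  [/\ representative P p, representative Q q &
      forall p' q', representative P p' -> representative Q q' ->
        Mdist k p q <= Mdist k p' q'].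

(* Main.v *)
Require Import Defs.
From HB Require Import structures.
From mathcomp Require Import all_boot all_order all_algebra.
From mathcomp Require Import all_classical all_reals all_analysis.
From mathcomp Require Import measurable_realfun ring lra.
Import Order.TTheory GRing.Theory Num.Theory.
Import numFieldNormedType.Exports.
Local Open Scope classical_set_scope.
Local Open Scope ring_scope.

(** Why the theorem is true.

   In the factors, the pre-Segre--Veronese manifold is a cone: along the great
   circles that join the factors of [p] to those of [q], the length [rho] and
   [alpha] times the angular distance travelled are polar coordinates of a flat
   sector.  As [alpha * Mdist k p q < pi], the segment of the plane between the
   points [(radius p, 0)] and [(radius q, alpha * Mdist k p q)] avoids the apex,
   and it lifts to a curve [geodesic] from [p] to [q] of constant speed, of length
   [L] and with initial velocity [pre_log] ([polar_chord_exists], [geodesic_speed],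
   [geodesic_velocity_start]).  The map [otimes] is a local isometry
   ([otimes_isometry]), so that the image of [geodesic] also has length [L], and
   the chain rule yields its initial velocity.

   That no curve is shorter is shown by calibration ([minimizing_of_calibrates]):
   it suffices to find a function that never varies faster than the length, and
   that increases by [L] between the end points.  This function lives on the
   tensors, and it serves both manifolds, for the pre-manifold after composition
   with [otimes].  Let [fibre_dist p A] be the smallest value of [Mdist] between
   [p] and the representatives of [A]; the function [cone_coord] is the Euclidean
   coordinate, in the direction of the segment above, of the point of the plane
   with polar coordinates [enorm A] and [alpha * fibre_dist p A], the angle being
   cut at [alpha * Mdist k p q].  It increases by [L] because [p] and [q] are
   matched: [fibre_dist p Q] is [Mdist k p q].

   The argument stays on the tensors instead of lifting curves.  Two representatives of a tensor differ
   by signs of their factors ([fibre_flip]), which act by isometries, so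
   [fibre_dist p] is Lipschitz for [Mdist] ([fibre_dist_lip]); and tensors [A], [B]
   with [dot A B > 0] have representatives at [Mdist] at most
   [sqrt ((|A| |B| / dot A B) ^+ 2 - 1)] ([close_representatives]).  To first order
   in [B - A] this is the angle between [A] and [B], hence the increments of
   [cone_coord] along a curve are bounded by the speed ([cone_coord_calibrates],
   [cone_coord_otimes_calibrates]).  The function may fail to be
   differentiable, but a local bound on its increments is enough to bound its total
   increase by the integral of the speed ([upper_slope_le_integral]). *)

Set Implicit Arguments.
Unset Strict Implicit.
Unset Printing Implicit Defensive.

(** * Finite sums and products *)

Lemma weighted_CS (R : realType) (I : finType) (w a b : I -> R) :
  (forall i, 0 <= w i) ->
  (\sum_i w i * (a i * b i)) ^+ 2 <=
  (\sum_i w i * a i ^+ 2) * (\sum_i w i * b i ^+ 2).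
Proof.
move=> w0; set X := \sum_i w i * (a i * b i); set A := \sum_i w i * a i ^+ 2.
set Y := \sum_i w i * b i ^+ 2.
have Y0 : 0 <= Y by apply: sumr_ge0 => i _; rewrite mulr_ge0 ?sqr_ge0.
have key : 0 <= Y * (A * Y - X ^+ 2).
  suff -> : Y * (A * Y - X ^+ 2) = \sum_i w i * (Y * a i - X * b i) ^+ 2.
    by apply: sumr_ge0 => i _; rewrite mulr_ge0 ?sqr_ge0.
  transitivity (\sum_i (Y ^+ 2 * (w i * a i ^+ 2) -
      2 * X * Y * (w i * (a i * b i)) + X ^+ 2 * (w i * b i ^+ 2))).
    rewrite big_split sumrB /= -!mulr_sumr -/X -/Y -/A; ring.
  by apply: eq_bigr => i _; ring.
have [Ypos|] := ltP 0 Y; first by rewrite pmulr_rge0// subr_ge0 in key.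
move=> Yle; have Yz : Y = 0 by apply/eqP; rewrite eq_le Yle Y0.
suff -> : X = 0 by rewrite Yz mulr0 expr0n.
apply: big1 => i _.
have := psumr_eq0P (fun i _ => mulr_ge0 (w0 i) (sqr_ge0 (b i))) Yz.
move=> /(_ i isT) /eqP; rewrite mulf_eq0 sqrf_eq0 => /orP[/eqP->|/eqP->];
  by rewrite ?mul0r ?mulr0.
Qed.

Lemma weighted_minkowski (R : realType) (I : finType) (w a b : I -> R) :
  (forall i, 0 <= w i) ->
  Num.sqrt (\sum_i w i * (a i + b i) ^+ 2) <=
  Num.sqrt (\sum_i w i * a i ^+ 2) + Num.sqrt (\sum_i w i * b i ^+ 2).
Proof.
move=> w0; set A := \sum_i w i * a i ^+ 2; set B := \sum_i w i * b i ^+ 2.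
have A0 : 0 <= A by apply: sumr_ge0 => i _; rewrite mulr_ge0 ?sqr_ge0.
have B0 : 0 <= B by apply: sumr_ge0 => i _; rewrite mulr_ge0 ?sqr_ge0.
have -> : \sum_i w i * (a i + b i) ^+ 2 =
    A + 2 * (\sum_i w i * (a i * b i)) + B.
  rewrite /A /B mulr_sumr -!big_split /=.
  by apply: eq_bigr => i _; ring.
rewrite -[leRHS]ger0_norm ?addr_ge0 ?sqrtr_ge0// -sqrtr_sqr.
rewrite ler_sqrt ?sqr_ge0// sqrrD !sqr_sqrtr//.
rewrite lerD2r lerD2l -[leRHS]mulr_natl ler_pM2l// -sqrtrM//.
apply: le_trans (ler_norm _) _; rewrite -sqrtr_sqr ler_sqrt ?mulr_ge0//.
exact: weighted_CS.
Qed.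

Lemma prod_sum_dffun (R : realType) (I : finType) (T : I -> finType)
    (F : forall i, T i -> R) :
  \sum_(f : {dffun forall i, T i}) \prod_i F i (f i) =
  \prod_i \sum_(x : T i) F i x.
Proof.
rewrite (reindex (@dffun_of_fprod I T)) /=; last exact/onW_bij/dffun_of_fprod_bij.
pose P i : {ffun T i -> R} := [ffun x => F i x].
have -> : \sum_(t : fprod T) \prod_i F i (dffun_of_fprod t i) =
    \sum_(t : fprod T) \prod_(i in I) P i (t i).
  apply: eq_bigr => t _; apply: eq_bigr => i _.
  by rewrite !ffunE.
rewrite big_fprod -(bigA_distr_big_dep _ (fun i j => untag 0 (P i) j)).
apply: eq_bigr => i _; rewrite -(big_tag P i).
by apply: eq_bigr => x _; rewrite ffunE.
Qed.

(** * Euclidean geometry of row vectors *)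

Section Dot.
Variables (R : realType) (m : nat).
Implicit Types u v w : 'rV[R]_m.

Lemma entryZ a u j : (a *: u) 0 j = a * u 0 j.
Proof. by rewrite mxE. Qed.

Lemma entryD u v j : (u + v) 0 j = u 0 j + v 0 j.
Proof. by rewrite mxE. Qed.

Lemma entryB u v j : (u - v) 0 j = u 0 j - v 0 j.
Proof. by rewrite !mxE. Qed.

Lemma dotC u v : dot u v = dot v u.
Proof. by apply: eq_bigr => j _; rewrite mulrC. Qed.

Lemma dotDl u v w : dot (u + v) w = dot u w + dot v w.
Proof.
by rewrite /dot -big_split /=; apply: eq_bigr => j _; rewrite mxE mulrDl.
Qed.

Lemma dotZl a u v : dot (a *: u) v = a * dot u v.
Proof. by rewrite /dot mulr_sumr; apply: eq_bigr => j _; rewrite mxE mulrA. Qed.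

Lemma dotZr a u v : dot u (a *: v) = a * dot u v.
Proof. by rewrite dotC dotZl dotC. Qed.

Lemma dotDr u v w : dot w (u + v) = dot w u + dot w v.
Proof. by rewrite dotC dotDl !(dotC w). Qed.

Lemma dotNl u v : dot (- u) v = - dot u v.
Proof. by rewrite -scaleN1r dotZl mulN1r. Qed.

Lemma dotNr u v : dot u (- v) = - dot u v.
Proof. by rewrite dotC dotNl dotC. Qed.

Lemma dotBl u v w : dot (u - v) w = dot u w - dot v w.
Proof. by rewrite dotDl dotNl. Qed.

Lemma dotBr u v w : dot w (u - v) = dot w u - dot w v.
Proof. by rewrite dotDr dotNr. Qed.

Lemma dot0l u : dot 0 u = 0.
Proof. by rewrite -(scale0r 0) dotZl mul0r. Qed.

Lemma dot0r u : dot u 0 = 0.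
Proof. by rewrite dotC dot0l. Qed.

Lemma dot_ge0 u : 0 <= dot u u.
Proof. by apply: sumr_ge0 => j _; rewrite -expr2 sqr_ge0. Qed.

Lemma dot_eq0 u : dot u u = 0 -> u = 0.
Proof.
move=> uu; apply/rowP => j; rewrite mxE.
have h i : 0 <= u 0 i * u 0 i by rewrite -expr2 sqr_ge0.
have /(_ j isT)/eqP := psumr_eq0P (fun i _ => h i) uu.
by rewrite mulf_eq0 orbb => /eqP.
Qed.

Lemma dotBB u v : dot (u - v) (u - v) = dot u u + dot v v - 2 * dot u v.
Proof. by rewrite dotBl !dotBr (dotC v u); ring. Qed.

Lemma dot_CS u v : dot u v ^+ 2 <= dot u u * dot v v.
Proof.
have := @weighted_CS R 'I_m (fun=> 1) (fun j => u 0 j) (fun j => v 0 j)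
  (fun=> ler01).
congr (_ ^+ 2 <= _ * _); apply: eq_bigr => j _; exact: mul1r.
Qed.

Lemma enorm_sqr u : enorm u ^+ 2 = dot u u.
Proof. by rewrite sqr_sqrtr ?dot_ge0. Qed.

Lemma enorm1E u : enorm u = 1 <-> dot u u = 1.
Proof.
split=> [u1|u1]; first by rewrite -enorm_sqr u1 expr1n.
by rewrite /enorm u1 sqrtr1.
Qed.

Lemma dot_unit_bound u v : dot u u = 1 -> dot v v = 1 -> -1 <= dot u v <= 1.
Proof.
move=> u1 v1; rewrite -ler_norml -(@ler_pXn2r _ 2) ?nnegrE// real_normK ?num_real//.
by rewrite expr1n (le_trans (dot_CS u v))// u1 v1 mulr1.
Qed.

(** By Cauchy--Schwarz for the components of [u] and [w] orthogonal to [v], the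
   cosine of the angle between [u] and [w] is at least the cosine of the sum of
   the two other angles. *)
Lemma angle_triangle u v w : dot u u = 1 -> dot v v = 1 -> dot w w = 1 ->
  angle u w <= angle u v + angle v w.
Proof.
move=> u1 v1 w1.
have uv := dot_unit_bound u1 v1; have vw := dot_unit_bound v1 w1.
have uw := dot_unit_bound u1 w1.
have in1 (x y : 'rV[R]_m) : -1 <= dot x y <= 1 -> dot x y \in `[(-1 : R), 1].
  by rewrite in_itv.
set a := angle u v; set b := angle v w.
have a0 : 0 <= a by exact: acos_ge0.
have b0 : 0 <= b by exact: acos_ge0.
have [ab|/ltW ab] := leP (a + b) pi; last first.
  by apply: le_trans ab; exact: acos_lepi.
have abI : a + b \in `[0, pi] by rewrite in_itv/= addr_ge0.
have uwI : angle u w \in `[0, pi].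
  by rewrite in_itv/= acos_ge0// acos_lepi.
rewrite leNgt -(ltr_cos abI uwI) -leNgt cosD.
rewrite /a /b /angle !acosK ?in1// !sin_acos//.
have cs := dot_CS (u - dot u v *: v) (w - dot v w *: v).
have E1 : dot (u - dot u v *: v) (w - dot v w *: v) = dot u w - dot u v * dot v w.
  by rewrite dotBl !dotBr !dotZl !dotZr v1; ring.
have E2 : dot (u - dot u v *: v) (u - dot u v *: v) = 1 - dot u v ^+ 2.
  by rewrite dotBB !dotZl !dotZr u1 v1; ring.
have E3 : dot (w - dot v w *: v) (w - dot v w *: v) = 1 - dot v w ^+ 2.
  by rewrite dotBB !dotZl !dotZr w1 v1 (dotC w v); ring.
rewrite E1 E2 E3 in cs.
have p1 : 0 <= 1 - dot u v ^+ 2 by rewrite -E2 dot_ge0.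
have p2 : 0 <= 1 - dot v w ^+ 2 by rewrite -E3 dot_ge0.
rewrite lerBlDr -lerBlDl -sqrtrM//.
apply: le_trans (ler_norm _) _; rewrite -sqrtr_sqr ler_sqrt ?mulr_ge0//.
by rewrite -sqrrN opprB.
Qed.

Lemma angleC u v : angle u v = angle v u.
Proof. by rewrite /angle dotC. Qed.

Lemma angle_ge0 u v : dot u u = 1 -> dot v v = 1 -> 0 <= angle u v.
Proof. by move=> u1 v1; exact: acos_ge0 (dot_unit_bound u1 v1). Qed.

Lemma cos_angle u v : dot u u = 1 -> dot v v = 1 -> cos (angle u v) = dot u v.
Proof. by move=> u1 v1; rewrite acosK// in_itv/= dot_unit_bound. Qed.

Lemma dot_eq1 u v : dot u u = 1 -> dot v v = 1 -> dot u v = 1 -> u = v.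
Proof.
move=> u1 v1 uv; apply/eqP; rewrite -subr_eq0; apply/eqP/dot_eq0.
by rewrite dotBB u1 v1 uv; ring.
Qed.

End Dot.

(** * Inequalities for cosines and products *)

Section Inequalities.
Variable R : realType.

Lemma mul_cos_le_sin (t : R) : 0 <= t <= pi -> t * cos t <= sin t.
Proof.
move=> /andP[t0 tpi].
pose g (s : R) := sin s - s * cos s.
have dg (s : R) : is_derive s 1 g (s * sin s).
  by apply: is_derive_eq; rewrite /GRing.scale /=; ring.
suff : g 0 <= g t by rewrite /g sin0 mul0r subr0 subr_ge0.
apply: (@ger0_derive1_le_cc R g 0 t) => //.
- move=> s; rewrite in_itv/= => /andP[s0 st].
  have [_ ds] := dg s.
  rewrite derive1E ds mulr_ge0 ?(ltW s0)// sin_ge0_pi// (ltW s0)/=.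
  by rewrite (le_trans (ltW st)).
- apply: continuous_subspaceT => s; apply: differentiable_continuous.
  by apply/derivable1_diffP; case: (dg s).
- by rewrite in_itv/= lexx.
- by rewrite in_itv/= t0 lexx.
Qed.

(** The right-hand side is [tan (acos x) ^+ 2], and [t <= tan t]. *)
Lemma sqr_acos_le (x : R) : 0 < x -> x <= 1 -> acos x ^+ 2 <= x^-1 ^+ 2 - 1.
Proof.
move=> x0 x1.
have xI : -1 <= x <= 1 by rewrite x1 andbT (le_trans _ (ltW x0))// lerN10.
have a0 := acos_ge0 xI.
have := @mul_cos_le_sin (acos x); rewrite a0 acos_lepi// => /(_ isT).
rewrite acosK ?in_itv// sin_acos// => h.
have x2 : 0 <= 1 - x ^+ 2 by rewrite subr_ge0 expr_le1// ltW.
have : (acos x * x) ^+ 2 <= 1 - x ^+ 2.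
  by rewrite -[leRHS]sqr_sqrtr// ler_pXn2r ?nnegrE ?sqrtr_ge0// mulr_ge0// ltW.
rewrite exprMn -ler_pdivlMr ?exprn_gt0// => /le_trans; apply.
by rewrite mulrBl mul1r divff ?expf_neq0 ?gt_eqF// exprVn.
Qed.

Lemma bernoulli_prod (I : finType) (k : I -> nat) (a : I -> R) :
  (forall i, 0 <= a i) ->
  1 + \sum_i (k i)%:R * a i <= \prod_i (1 + a i) ^+ k i.
Proof.
move=> a0.
have step (x y b c : R) : 0 <= b -> 0 <= c -> 1 + b <= x -> 1 + c <= y ->
  1 + (b + c) <= x * y.
  by move=> b0 c0 hx hy; nra.
suff [] : 0 <= \sum_i (k i)%:R * a i /\
  1 + \sum_i (k i)%:R * a i <= \prod_i (1 + a i) ^+ k i by [].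
apply: (big_rec2 (fun s p : R => 0 <= s /\ 1 + s <= p)).
  by rewrite addr0.
move=> i p s _ [s0 sp].
have c0 : 0 <= (k i)%:R * a i by rewrite mulr_ge0.
split; first by rewrite addr_ge0.
apply: (step) => //.
elim: (k i) => [|m IH]; first by rewrite mul0r addr0 expr0.
rewrite exprS -natr1 mulrDl mul1r [_ * a i + a i]addrC.
by apply: (step) => //; rewrite mulr_ge0.
Qed.

(** From [1 - x * y = (1 - x) + x * (1 - y)] with [x <= 1]: the defects add up. *)
Lemma prod_defect (I : finType) (k : I -> nat) (c : I -> R) :
  (forall i, -1 <= c i <= 1) ->
  1 - \sum_i (k i)%:R * (1 - c i) <= \prod_i c i ^+ k i.
Proof.
move=> hc.
have step (x y a b : R) : -1 <= x <= 1 -> -1 <= y <= 1 -> 1 - a <= x ->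
  1 - b <= y -> -1 <= x * y <= 1 /\ 1 - (a + b) <= x * y.
  move=> /andP[? ?] /andP[? ?] ? ?.
  by split; [apply/andP; split|]; nra.
suff [] : -1 <= \prod_i c i ^+ k i <= 1 /\
  1 - \sum_i (k i)%:R * (1 - c i) <= \prod_i c i ^+ k i by [].
apply: (big_rec2 (fun s p : R => -1 <= p <= 1 /\ 1 - s <= p)).
  by rewrite subr0 lexx ltW// ltrN1.
move=> i p s _ [hp sp].
suff [h1 h2] : -1 <= c i ^+ k i <= 1 /\ 1 - (k i)%:R * (1 - c i) <= c i ^+ k i.
  exact: step.
elim: (k i) => [|m [h1 h2]].
  by rewrite mul0r subr0 expr0 lexx ltW// ltrN1.
rewrite exprS -natr1 mulrDl mul1r [_ + (1 - c i)]addrC.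
by apply: (step) => //; rewrite subKr.
Qed.

Lemma prod_le_expR (I : finType) (k : I -> nat) (c : I -> R) :
  (forall i, 0 <= c i) ->
  \prod_i c i ^+ k i <= expR (- \sum_i (k i)%:R * (1 - c i)).
Proof.
move=> c0; rewrite -sumrN expR_sum; apply: ler_prod => i _.
rewrite exprn_ge0//= -mulrN expRM_natl lerXn2r ?nnegrE ?expR_ge0//.
by rewrite (le_trans _ (expR_ge1Dx _))// opprB addrC subrK.
Qed.

End Inequalities.

(** * Rank-one tensors and their representatives *)

Section Tensors.
Variables (R : realType) (d : nat) (n k : 'I_d -> nat).
Hypothesis k_gt0 : forall i, (0 < k i)%N.
Implicit Types (p q x y z : pre_space R n) (A B : tensor R n k).

Local Notation radius := (@Defs.radius R d n).
Local Notation otimes := (@Defs.otimes R d n k).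
Local Notation Mdist := (@Defs.Mdist R d n k).

Lemma pre_unit x i : pre_segre_veronese x -> dot (part x i) (part x i) = 1.
Proof. by move=> [_ /(_ i)] /enorm1E. Qed.

Lemma dot_otimes x y : dot (otimes x) (otimes y) =
  radius x * radius y * \prod_i dot (part x i) (part y i) ^+ k i.
Proof.
pose F i (f : {ffun 'I_(k i) -> 'I_(n i)}) : R :=
  \prod_l (part x i 0 (f l) * part y i 0 (f l)).
transitivity (\sum_(J : multi_index n k) radius x * radius y * \prod_i F i (J i)).
  rewrite /dot (reindex (@enum_rank (multi_index n k))) /=; last first.
    by apply: onW_bij; exact: enum_rank_bij.
  apply: eq_bigr => J _; rewrite !mxE enum_rankK.
  rewrite mulrACA -big_split /=; congr (_ * _).
  by apply: eq_bigr => i _; rewrite -big_split.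
rewrite -mulr_sumr prod_sum_dffun; congr (_ * _); apply: eq_bigr => i _.
rewrite -(bigA_distr_bigA (fun _ j => part x i 0 j * part y i 0 j)).
by rewrite big_const card_ord iter_mulr_1.
Qed.

Lemma dot_otimesxx x : pre_segre_veronese x ->
  dot (otimes x) (otimes x) = radius x ^+ 2.
Proof.
move=> px; rewrite dot_otimes big1 ?mulr1 ?expr2// => i _.
by rewrite pre_unit// expr1n.
Qed.

Lemma enorm_otimes x : pre_segre_veronese x -> enorm (otimes x) = radius x.
Proof.
by move=> px; rewrite /enorm dot_otimesxx// sqrtr_sqr gtr0_norm//; case: px.
Qed.

(** With signs [s i] such that the product of the [s i ^+ k i] is one, these maps
   permute the representatives of a tensor. *)
Definition flip (s : 'I_d -> R) x : pre_space R n :=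
  (radius x, \mxrow_i (s i *: part x i)).

Lemma radius_flip s x : radius (flip s x) = radius x.
Proof. by []. Qed.

Lemma part_flip s x i : part (flip s x) i = s i *: part x i.
Proof. by rewrite /part /flip /= mxrowK. Qed.

Lemma pre_eq x y : radius x = radius y -> (forall i, part x i = part y i) ->
  x = y.
Proof.
by case: x y => [r u] [r' v] /= -> H; congr (_, _); apply/mxrowP => i; exact: H.
Qed.

Lemma representative_flip s A x : (forall i, s i ^+ 2 = 1) ->
  \prod_i s i ^+ k i = 1 -> representative A x -> representative A (flip s x).
Proof.
move=> s2 s1 [[r0 xu] <-]; split.
  split=> // i; apply/enorm1E.
  by rewrite part_flip dotZl dotZr mulrA -expr2 s2 mul1r; apply/enorm1E/xu.
apply/rowP => j; rewrite !mxE /=; congr (_ * _).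
rewrite -[RHS]mul1r -[X in _ = X * _]s1 -big_split /=; apply: eq_bigr => i _.
rewrite (eq_bigr (fun l => s i * part x i 0 ((enum_val j : multi_index n k) i l))).
  by rewrite big_split /= prodr_const card_ord.
by move=> l _; rewrite part_flip mxE.
Qed.

Lemma Mdist_flip s x y : (forall i, s i ^+ 2 = 1) ->
  Mdist (flip s x) (flip s y) = Mdist x y.
Proof.
move=> s2; rewrite /Defs.Mdist; congr Num.sqrt; apply: eq_bigr => i _.
by rewrite /angle !part_flip dotZl dotZr mulrA -expr2 s2 mul1r.
Qed.

(** Cauchy--Schwarz must be an equality in every factor of [dot_otimes]. *)
Lemma fibre_flip A x y : representative A x -> representative A y ->
  exists s : 'I_d -> R, [/\ forall i, s i ^+ 2 = 1, \prod_i s i ^+ k i = 1 &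
    y = flip s x].
Proof.
move=> [px ox] [py oy].
have x0 := px.1; have y0 := py.1.
have oxy : otimes x = otimes y by rewrite ox oy.
have rE : radius x = radius y by rewrite -!enorm_otimes// ox oy.
(* Two unit vectors of cosine [1] or [-1] are equal or opposite. *)
pose s i := dot (part x i) (part y i).
have sb i : -1 <= s i <= 1 by exact: dot_unit_bound (pre_unit _ px) (pre_unit _ py).
have s1 : \prod_i s i ^+ k i = 1.
  have r2 : radius y ^+ 2 != 0 by rewrite expf_neq0// gt_eqF.
  apply: (mulfI r2); rewrite mulr1 -[RHS](dot_otimesxx py).
  by rewrite -{1}oxy dot_otimes rE expr2.
have s2 i : s i ^+ 2 = 1.
  suff : 1 <= `|s i|.
    move=> h; rewrite -real_normK ?num_real//.
    suff -> : `|s i| = 1 by rewrite expr1n.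
    by apply/eqP; rewrite eq_le h andbT ler_norml.
  have : `|\prod_i s i ^+ k i| = 1 by rewrite s1 normr1.
  rewrite normr_prod (bigD1 i)//= => h.
  have le1 j : 0 <= `|s j ^+ k j| <= 1.
    by rewrite normr_ge0 normrX exprn_ile1// ler_norml.
  have : 1 <= `|s i ^+ k i|.
    rewrite -h ler_piMr//.
    by apply: prodr_ile1 => j _; exact: le1.
  rewrite normrX => h1; apply: le_trans h1 _.
  rewrite -(prednK (k_gt0 i)) exprS ler_piMr// exprn_ile1// ler_norml; exact: sb.
exists s; split=> //; apply: pre_eq => [|i]; first by rewrite radius_flip rE.
rewrite part_flip; apply/eqP; rewrite -subr_eq0; apply/eqP/dot_eq0.
rewrite dotBB !dotZl !dotZr !pre_unit// (dotC (part y i)) -/(s i).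
by have := s2 i; rewrite expr2 => s2i; lra.
Qed.

Lemma Mdist_ge0 x y : 0 <= Mdist x y.
Proof. exact: sqrtr_ge0. Qed.

Lemma Mdist_sum_ge0 x y :
  0 <= \sum_i (k i)%:R * angle (part x i) (part y i) ^+ 2.
Proof. by apply: sumr_ge0 => i _; rewrite mulr_ge0 ?sqr_ge0. Qed.

Lemma MdistC x y : Mdist x y = Mdist y x.
Proof.
by rewrite /Defs.Mdist; congr Num.sqrt; apply: eq_bigr => i _; rewrite angleC.
Qed.

Lemma Mdistxx x : pre_segre_veronese x -> Mdist x x = 0.
Proof.
move=> px; rewrite /Defs.Mdist big1 ?sqrtr0// => i _.
by rewrite /angle pre_unit// acos1 expr0n mulr0.
Qed.

Lemma Mdist_triangle x y z : pre_segre_veronese x -> pre_segre_veronese y ->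
  pre_segre_veronese z -> Mdist x z <= Mdist x y + Mdist y z.
Proof.
move=> px py pz.
apply: le_trans (weighted_minkowski (fun i => angle (part x i) (part y i))
  (fun i => angle (part y i) (part z i)) (fun i => ler0n R (k i))).
rewrite ler_sqrt ?sumr_ge0//; last by move=> i _; rewrite mulr_ge0 ?sqr_ge0.
apply: ler_sum => i _; rewrite ler_wpM2l// lerXn2r ?nnegrE ?addr_ge0//;
  rewrite ?angle_ge0 ?pre_unit//.
by apply: angle_triangle; exact: pre_unit.
Qed.

(** The angular part of the distance from [p] to the fibre over [A]; unlike
   [Mdist], it makes sense along curves of tensors that are not lifted. *)
Definition fibre_dist p A : R := inf [set Mdist p x | x in representative A].

Lemma fibre_dist_le p A x : representative A x -> fibre_dist p A <= Mdist p x.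
Proof.
move=> rx; apply: ge_inf; last by exists x.
by exists 0 => _ [z _ <-]; exact: Mdist_ge0.
Qed.

Lemma le_fibre_dist p A x (m : R) : representative A x ->
  (forall y, representative A y -> m <= Mdist p y) -> m <= fibre_dist p A.
Proof.
move=> rx h; apply: lb_le_inf; first by exists (Mdist p x), x.
by move=> _ [z /h ? <-].
Qed.

Lemma fibre_dist_ge0 p A x : representative A x -> 0 <= fibre_dist p A.
Proof. by move=> rx; apply: le_fibre_dist rx _ => y _; exact: Mdist_ge0. Qed.

(** The sign changes that carry [y] to another representative of [A] carry [z]
   along, without altering [Mdist y z]. *)
Lemma fibre_dist_lip p A B y z : pre_segre_veronese p ->
  representative A y -> representative B z ->
  fibre_dist p B <= fibre_dist p A + Mdist y z.
Proof.
move=> pp ry rz; rewrite -lerBlDr; apply: (le_fibre_dist ry) => x rx.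
have [s [s2 s1 xE]] := fibre_flip ry rx.
have rz' := representative_flip s2 s1 rz.
rewrite lerBlDr -(Mdist_flip y z s2) -xE.
apply: le_trans (fibre_dist_le p rz') _.
by apply: Mdist_triangle => //; [case: rx|case: rz'].
Qed.

(** Once signs make all the cosines [c i] of the angles between factors positive,
   the squared angles are at most [c i ^- 2 - 1], and Bernoulli's inequality sums
   these into the product of the [c i ^- (2 * k i)], which [dot_otimes] expresses
   by [A] and [B] alone. *)
Lemma close_representatives A B x y : representative A x -> representative B y ->
  0 < dot A B -> exists z, representative B z /\
    Mdist x z ^+ 2 <= (enorm A * enorm B / dot A B) ^+ 2 - 1.
Proof.
move=> rx ry AB.
have [px ox] := rx; have [py oy] := ry.
pose c i := dot (part x i) (part y i).
have ABE : dot A B = radius x * radius y * \prod_i c i ^+ k i.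
  by rewrite -ox -oy dot_otimes.
have r0 : 0 < radius x * radius y by rewrite mulr_gt0//; [case: px|case: py].
have c0 : 0 < \prod_i c i ^+ k i by move: AB; rewrite ABE pmulr_rgt0.
have cn0 i : c i != 0.
  apply: contraTneq c0 => ci; rewrite (bigD1 i)//= ci expr0n.
  by rewrite gtn_eqF ?k_gt0// mul0r ltxx.
pose s i : R := Num.sg (c i).
have s2 i : s i ^+ 2 = 1 by rewrite /s sqr_sg cn0.
have s1 : \prod_i s i ^+ k i = 1.
  rewrite -[RHS](gtr0_sg c0) (big_morph _ (@sgrM R) (@sgr1 R)).
  by apply: eq_bigr => i _; rewrite sgrX.
have rz := representative_flip s2 s1 ry.
exists (flip s y); split=> //.
have dE i : dot (part x i) (part (flip s y) i) = `|c i|.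
  by rewrite part_flip dotZr -/(c i) /s -normrEsg.
have cb i : `|c i| <= 1.
  by rewrite ler_norml; exact: dot_unit_bound (pre_unit _ px) (pre_unit _ py).
have ci0 i : 0 < `|c i| by rewrite normr_gt0.
rewrite sqr_sqrtr ?Mdist_sum_ge0// /angle.
have -> : enorm A * enorm B / dot A B = \prod_i (`|c i|^-1) ^+ k i.
  rewrite -ox -oy !enorm_otimes// dot_otimes invfM mulrA divff ?gt_eqF// mul1r.
  rewrite -/c -(gtr0_norm c0) normr_prod -prodfV; apply: eq_bigr => i _.
  by rewrite normrX exprVn.
rewrite -prodrXl lerBrDl.
pose a i := `|c i|^-1 ^+ 2 - 1.
apply: (@le_trans _ _ (1 + \sum_i (k i)%:R * a i)).
  rewrite lerD2l; apply: ler_sum => i _; rewrite ler_wpM2l// dE.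
  exact: sqr_acos_le.
apply: le_trans (bernoulli_prod _ _) _ => [i|].
  rewrite /a subr_ge0 exprn_ege1// invf_ge1//.
rewrite le_eqVlt; apply/orP; left; apply/eqP; apply: eq_bigr => i _.
by rewrite /a addrC subrK -!exprM mulnC.
Qed.

Lemma fibre_dist_near p A B x y : pre_segre_veronese p ->
  representative A x -> representative B y -> 0 < dot A B ->
  `|fibre_dist p B - fibre_dist p A| <=
  Num.sqrt ((enorm A * enorm B / dot A B) ^+ 2 - 1).
Proof.
move=> pp rx ry AB.
have [z [rz Mz]] := close_representatives rx ry AB.
apply: (@le_trans _ _ (Mdist x z)).
  have := fibre_dist_lip pp rx rz.
  have := fibre_dist_lip pp rz rx; rewrite MdistC.
  by rewrite ler_norml => ? ?; apply/andP; split; lra.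
rewrite -[leLHS]ger0_norm ?Mdist_ge0// -sqrtr_sqr ler_sqrt//.
exact: le_trans (sqr_ge0 _) Mz.
Qed.

End Tensors.

(** * Functions with locally bounded increments *)

Section Growth.
Variable R : realType.
Implicit Types (a b t : R) (f g phi sigma : R -> R).

(** The supremum of the points where [f] is at most [f a] is such a point, by the
   local hypothesis on its left, and it is [b], by the one on its right. *)
Lemma nonincreasing_from_local f a b : a <= b ->
  (forall t, a <= t <= b -> \forall s \near t, a <= s <= b ->
    (t <= s -> f s <= f t) /\ (s <= t -> f t <= f s)) ->
  f b <= f a.
Proof.
move=> ab loc.
pose E := [set t | a <= t <= b /\ f t <= f a].
have Ea : E a by split; rewrite ?lexx.
have ubE : ubound E b by move=> t [/andP[]].
have supE : has_sup E by split; [exists a|exists b].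
set T := sup E.
have aT : a <= T by exact: ub_le_sup supE.2 _ Ea.
have Tb : T <= b by exact: ge_sup supE.1 ubE.
have TI : a <= T <= b by rewrite aT.
have /nbhs_ballP[e /= e0 He] := loc _ TI.
have ET : E T.
  split=> //; have [s Es sT] := sup_adherent e0 supE.
  have sleT : s <= T by exact: ub_le_sup supE.2 _ Es.
  have sball : ball T e s.
    by rewrite /ball/= ger0_norm ?subr_ge0//; rewrite -/T in sT; lra.
  have [_ /(_ sleT) fTs] := He s sball Es.1.
  exact: le_trans fTs Es.2.
move: (Tb); rewrite le_eqVlt => /predU1P[<-|Tltb]; first exact: ET.2.
exfalso; pose s := Num.min (T + e / 2) b.
have Ts : T < s by rewrite lt_min Tltb andbT; lra.
have sb : s <= b by rewrite ge_min lexx orbT.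
have se : s <= T + e / 2 by rewrite ge_min lexx.
have sI : a <= s <= b by rewrite sb andbT (le_trans aT)// ltW.
have sball : ball T e s by rewrite /ball/= ltr0_norm ?subr_lt0//; lra.
have [/(_ (ltW Ts)) fs _] := He s sball sI.
have Es : E s by split=> //; exact: le_trans fs ET.2.
by have := ub_le_sup supE.2 Es; rewrite leNgt Ts.
Qed.

Lemma near_increment (P : R -> Prop) t : (\forall h \near 0^', P h) ->
  \forall s \near t, s != t -> P (s - t).
Proof.
move=> /nbhs_ballP[e /= e0 He]; apply/nbhs_ballP; exists e => //= s st sNt.
by apply: He; rewrite /= ?subr_eq0// /ball/= sub0r opprB.
Qed.

(** Truncation turns continuity within a segment into continuity on the line. *)
Definition clamp a b t := Num.max a (Num.min t b).

Lemma clamp_in a b t : a <= b -> a <= clamp a b t <= b.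
Proof.
by move=> ab; rewrite /clamp le_max lexx/= ge_max ab/= ge_min lexx orbT.
Qed.

Lemma clamp_id a b t : a <= t <= b -> clamp a b t = t.
Proof. by move=> /andP[at_ tb]; rewrite /clamp min_l// max_r. Qed.

Lemma clamp_lip a b s t : `|clamp a b s - clamp a b t| <= `|s - t|.
Proof.
have maxL (x y : R) : `|Num.max a x - Num.max a y| <= `|x - y|.
  have := ler_norm (x - y); have := ler_norm (- (x - y)); rewrite normrN.
  rewrite ler_norml; case: (leP a x) => ?; case: (leP a y) => ? ? ?;
    by apply/andP; split; lra.
apply: le_trans (maxL _ _) _.
have := ler_norm (s - t); have := ler_norm (- (s - t)); rewrite normrN.
rewrite ler_norml; case: (leP s b) => ?; case: (leP t b) => ? ? ?;
  by apply/andP; split; lra.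
Qed.

Lemma continuous_clamp a b sigma : a <= b ->
  {within `[a, b], continuous sigma} -> continuous (sigma \o clamp a b).
Proof.
move=> ab /subspace_continuousP cs t.
have tI : `[a, b]%classic (clamp a b t) by rewrite /= in_itv/= clamp_in.
apply: cvg_comp (cs _ tI) => B /= [e e0 He].
apply/nbhs_ballP; exists e => //= s st.
apply: He; last by rewrite /= in_itv/= clamp_in.
by apply: le_lt_trans st; exact: clamp_lip.
Qed.

Lemma antiderivative f a b : a < b -> continuous f ->
  exists F : R -> R, (forall t, a <= t <= b -> is_derive t 1 F (f t)) /\
   ((F b - F a)%:E = \int[lebesgue_measure]_(t in `[a, b]) (f t)%:E)%E.
Proof.
move=> ab cf.
pose F x := \int[lebesgue_measure]_(t in `[a - 1, x]) f t.
have dF t : a <= t <= b -> is_derive t 1 F (f t).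
  move=> /andP[at_ tb].
  have itb : lebesgue_measure.-integrable `[a - 1, b + 1] (EFin \o f).
    apply: continuous_compact_integrable; first exact: segment_compact.
    exact: continuous_subspaceT.
  have [||d1 d2] := @continuous_FTC1_closed R f (a - 1) t (b + 1) _ itb _ (cf t).
  - by lra.
  - by lra.
  by rewrite derive1E in d2; split.
exists F; split=> //.
rewrite (@continuous_FTC2 R f F)//.
- by apply: continuous_subspaceT.
- split.
  + move=> t; rewrite in_itv/= => /andP[t1 t2].
    by have [] := dF t; rewrite ?(ltW t1) ?(ltW t2).
  + apply: cvg_at_right_filter; apply/differentiable_continuous/derivable1_diffP.
    by have [] := dF a; rewrite ?lexx ?ltW.
  + apply: cvg_at_left_filter; apply/differentiable_continuous/derivable1_diffP.
    by have [] := dF b; rewrite ?lexx ?ltW.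
- move=> t; rewrite in_itv/= => /andP[t1 t2]; rewrite derive1E.
  by have [] := dF t; rewrite ?(ltW t1) ?(ltW t2).
Qed.

(** A bound on increments instead of a derivative: minima over representatives
   satisfy it, though they may fail to be differentiable. *)
Definition upper_slope sigma a b phi := forall t, a <= t <= b ->
  exists2 g, g h @[h --> 0^'] --> sigma t &
  \forall h \near 0^', a <= t + h <= b -> `|phi (t + h) - phi t| <= `|h| * g h.

(** For every [e > 0], subtracting an antiderivative of [sigma] and [e] times the
   identity from [phi] leaves a function that is locally nonincreasing. *)
Lemma upper_slope_le_integral sigma a b phi : a < b ->
  {within `[a, b], continuous sigma} -> upper_slope sigma a b phi ->
  ((phi b - phi a)%:E <=
   \int[lebesgue_measure]_(t in `[a, b]) (sigma t)%:E)%E.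
Proof.
move=> ab cs slope.
have [F [dF FI]] := antiderivative ab (continuous_clamp (ltW ab) cs).
have -> : (\int[lebesgue_measure]_(t in `[a, b]) (sigma t)%:E =
    \int[lebesgue_measure]_(t in `[a, b]) ((sigma \o clamp a b) t)%:E)%E.
  by apply: eq_integral => t; rewrite inE/= in_itv/= => tI; rewrite clamp_id.
rewrite -FI lee_fin.
suff key e : 0 < e -> phi b - F b - e * b <= phi a - F a - e * a.
  apply/ler_addgt0Pr => e e0.
  have ba : 0 < b - a by rewrite subr_gt0.
  have := key (e / (b - a)) (divr_gt0 e0 ba).
  have -> : phi b - F b - e / (b - a) * b =
    phi b - F b - e / (b - a) * a - e / (b - a) * (b - a) by ring.
  by rewrite divfK ?gt_eqF//; lra.
move=> e0; apply: (@nonincreasing_from_local (fun t => phi t - F t - e * t)).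
  exact: ltW.
move=> t tI.
have [g gs gb] := slope t tI.
have [dFt dFE] := dF t tI; rewrite /= clamp_id// in dFE.
have e2 : 0 < e / 2 by rewrite divr_gt0.
have : \forall h \near 0^', `|h^-1 *: (F (h *: 1 + t) - F t) - sigma t| < e / 2.
  have : (h^-1 *: (F (h *: 1 + t) - F t)) @[h --> 0^'] --> sigma t.
    by rewrite -dFE; exact: dFt.
  by move/cvgrPdist_lt => /(_ _ e2); apply: filterS => h; rewrite distrC.
have : \forall h \near 0^', `|g h - sigma t| < e / 2.
  by move/cvgrPdist_lt : gs => /(_ _ e2); apply: filterS => h; rewrite distrC.
move=> /(near_increment t) gnear /(near_increment t) Fnear.
move: gb => /(near_increment t) phinear.
near=> s => sI.
have [->|st] := eqVneq s t; first by [].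
have gs' : `|g (s - t) - sigma t| < e / 2 by apply: (near gnear s).
have Fs : `|(s - t)^-1 *: (F ((s - t) *: 1 + t) - F t) - sigma t| < e / 2.
  by apply: (near Fnear s).
have ps : `|phi s - phi t| <= `|s - t| * g (s - t).
  have -> : s = t + (s - t) by ring.
  rewrite [t + (s - t) - t]addrAC subrr add0r.
  by apply: (near phinear s) => //; rewrite [t + _]addrC subrK.
set h := s - t in gs' Fs ps *.
have h0 : h != 0 by rewrite subr_eq0.
have sE : h *: 1 + t = s by rewrite /h scaler1 subrK.
rewrite sE in Fs.
have FsE : F s - F t = h * (h^-1 *: (F s - F t)) by rewrite /GRing.scale/= mulrA divff// mul1r.
set D := h^-1 *: (F s - F t) in Fs FsE.
move: gs' Fs; rewrite !ltr_norml => /andP[_ g2] /andP[D1 _].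
have pu : `|phi s - phi t| <= `|h| * (D + e).
  by apply: le_trans ps _; rewrite ler_wpM2l//; lra.
split=> hst.
- have hE : `|h| = h by rewrite ger0_norm// /h subr_ge0.
  have := le_trans (ler_norm _) pu; rewrite hE mulrDr -FsE /h; lra.
- have hE : `|h| = - h by rewrite ler0_norm// /h subr_le0.
  rewrite distrC in pu.
  have := le_trans (ler_norm _) pu; rewrite hE mulNr mulrDr -FsE /h; lra.
Unshelve. all: by end_near. Qed.

End Growth.

(** * Lower bounds for lengths by calibration *)

Section LengthBound.
Variables (R : realType) (V : normedModType R).
Variables (X : set V) (g : V -> V -> V -> R).
Implicit Types (a b : R) (c e : R -> V) (Phi : V -> R).

Lemma speed_ge0 c t : 0 <= speed g c t.
Proof. exact: sqrtr_ge0. Qed.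

Lemma derive1_eq_on c e a b t : a < t < b ->
  (forall s, a <= s <= b -> c s = e s) -> derive1 c t = derive1 e t.
Proof.
move=> /andP[at_ tb] ce; rewrite !derive1E; apply: near_eq_derive.
near=> s; apply: ce; apply/andP; split.
- by near: s; exact: lt_le_nbhsr.
- by near: s; exact: lt_le_nbhsl.
Unshelve. all: by end_near. Qed.

Lemma speed_eq_on c e a b t : a < t < b ->
  (forall s, a <= s <= b -> c s = e s) -> speed g c t = speed g e t.
Proof.
move=> tab ce; rewrite /speed (derive1_eq_on tab ce) ce//.
by case/andP: tab => /ltW -> /ltW ->.
Qed.

(** A non-smooth calibration: on curves with values in [X], the increments of
   [Phi] are at most those of the length for [g].  Continuity of the speed comes
   along, as it may fail outside [X]. *)
Definition calibrates Phi := forall a b e, a < b ->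
  (forall t, derivable e t 1) -> continuous (derive1 e) ->
  (forall t, a <= t <= b -> X (e t)) ->
  {within `[a, b], continuous (speed g e)} /\
  upper_slope (speed g e) a b (Phi \o e).

Lemma calibrates_piece Phi a b c : calibrates Phi -> a < b -> C1_on a b c ->
  (forall t, a <= t <= b -> X (c t)) ->
  measurable_fun `[a, b] (speed g c) /\
  ((Phi (c b) - Phi (c a))%:E <=
   \int[lebesgue_measure]_(t in `[a, b]) (speed g c t)%:E)%E.
Proof.
move=> cal ab [e [de ce eE]] Xc.
have Xe t : a <= t <= b -> X (e t) by move=> tab; rewrite -eE//; exact: Xc.
have [cs slope] := cal a b e ab de ce Xe.
have sE : {in `]a, b[, speed g e =1 speed g c}.
  by move=> t; rewrite in_itv/= => tab; rewrite (speed_eq_on tab eE).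
have me : measurable_fun `]a, b[ (speed g e).
  apply: (@measurable_funS _ _ _ _ `[a, b]) => //.
    exact: subset_itv_oo_cc.
  exact: subspace_continuous_measurable_fun.
have mc : measurable_fun `]a, b[ (speed g c).
  by apply: eq_measurable_fun me => t; rewrite inE/=; exact: sE.
split; first exact: measurable_fun_itv_cc mc.
rewrite -(@eq_integral_itv_bounded R a b _ _ true false me mc sE).
have := upper_slope_le_integral ab cs slope.
by rewrite /= -!eE// ?lexx ?(ltW ab).
Qed.

Lemma calibrates_pieces Phi a b s c : calibrates Phi -> itv_partition a b s ->
  (forall j, (j < size s)%N -> C1_on (nth b (a :: s) j) (nth b s j) c) ->
  (forall t, a <= t <= b -> X (c t)) ->
  measurable_fun `[a, b] (speed g c) /\
  ((Phi (c b) - Phi (c a))%:E <=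
   \int[lebesgue_measure]_(t in `[a, b]) (speed g c t)%:E)%E.
Proof.
move=> cal; elim: s a => [|x s IH] a part pieces Xc.
  rewrite -(itv_partition_nil part) set_itv1 subrr.
  split; first exact: measurable_fun_set1.
  by rewrite integral_set1.
have ax : a < x by case: part => /= /andP[].
have part' := itv_partition_cons part.
have xb : x <= b := itv_partition_le part'.
have Xax t : a <= t <= x -> X (c t).
  by move=> /andP[at_ tx]; apply: Xc; rewrite at_ (le_trans tx).
have Xxb t : x <= t <= b -> X (c t).
  by move=> /andP[xt tb]; apply: Xc; rewrite tb (le_trans (ltW ax)).
have [m1 i1] := calibrates_piece cal ax (pieces 0%N isT) Xax.
have [m2 i2] := IH x part' (fun j => pieces j.+1) Xxb.
have U : `[a, b]%classic = `[a, x] `|` `]x, b].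
  by apply: itv_bndbnd_setU; rewrite bnd_simp// ltW.
have m2' : measurable_fun `]x, b] (speed g c).
  by apply/measurable_fun_itv_obnd_cbndP.
have mU : measurable_fun `[a, b] (speed g c).
  by rewrite U; apply/measurable_funU.
split=> //; rewrite U ge0_integral_setU//.
- have -> : (Phi (c b) - Phi (c a))%:E =
    ((Phi (c x) - Phi (c a))%:E + (Phi (c b) - Phi (c x))%:E)%E.
    by rewrite -EFinD; congr EFin; ring.
  apply: leeD => //.
  rewrite integral_itv_obnd_cbnd//; exact/measurable_EFinP.
- by rewrite -U; exact/measurable_EFinP.
- by move=> t _; rewrite lee_fin speed_ge0.
- apply/disj_setPS => t /=; rewrite !in_itv/= => -[/andP[_ tx] /andP[xt _]].
  by move: xt; rewrite ltNge tx.
Qed.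

Lemma calibrates_dist Phi x y : calibrates Phi ->
  ((Phi y - Phi x)%:E <= intrinsic_dist X g x y)%E.
Proof.
move=> cal; apply: le_ereal_inf_tmp => _ [c [[s [part pieces]] [Xc <- <-]] <-].
by have [] := calibrates_pieces cal part pieces Xc.
Qed.

(** Every competitor is at least as long as [Phi] increases between the end
   points, and the curve [c] attains this bound. *)
Lemma minimizing_of_calibrates Phi x y c (L : R) : calibrates Phi ->
  C1_on 0 1 c -> joins X x y c -> (forall t : R, 0 < t < 1 -> speed g c t = L) ->
  L <= Phi y - Phi x -> minimizing_geodesic X g x y c.
Proof.
move=> cal C1c jc sL LPhi.
have lenL : curve_length g c = L%:E.
  have mL : measurable_fun `](0 : R), 1[ (cst L) by exact: measurable_cst.
  have sE : {in `](0 : R), 1[, cst L =1 speed g c}.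
    by move=> t; rewrite in_itv/= => t01; rewrite sL.
  have ms : measurable_fun `](0 : R), 1[ (speed g c).
    by apply: eq_measurable_fun mL => t; rewrite inE/=; exact: sE.
  rewrite /curve_length -(@eq_integral_itv_bounded R 0 1 _ _ true false mL ms sE).
  transitivity (\int[lebesgue_measure]_(t in `[0%R, 1%R]) cst (L%:E) t)%E => //.
  rewrite integral_cst//= lebesgue_measure_itv/= lte_fin ltr01.
  by rewrite oppr0 adde0 mule1.
split=> //; first by exists L.
apply/eqP; rewrite eq_le; apply/andP; split; last first.
  apply: ereal_inf_lbound; exists c => //; split=> //.
  exists [:: 1]; split; first exact: itv_partition1.
  by case.
rewrite lenL; apply: le_trans (calibrates_dist x y cal).
by rewrite lee_fin.
Qed.

End LengthBound.

(** * The calibrating function *)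

Section Limits.
Variable R : realType.

Lemma sqr_sin_le (x : R) : sin x ^+ 2 <= x ^+ 2.
Proof.
wlog x0 : x / 0 <= x.
  move=> H; have [|/ltW x0] := leP 0 x; first exact: H.
  by rewrite -sqrrN -sinN -[leRHS]sqrrN; apply: H; rewrite oppr_ge0.
have cs : {within `[0, x], continuous (@sin R)}.
  by apply: continuous_subspaceT => y; exact: continuous_sin.
have [c _] := MVT_segment x0 (fun y _ => is_derive_sin y) cs.
rewrite sin0 !subr0 => ->; rewrite exprMn ler_piMl ?sqr_ge0//.
Qed.

Lemma cos_ge_quadratic (x : R) : 1 - x ^+ 2 / 2 <= cos x.
Proof.
have xE : x = (x / 2) *+ 2 by rewrite -mulr_natr divfK.
rewrite [in leRHS]xE cos_mulr2n cos2sin2.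
have := sqr_sin_le (x / 2); rewrite expr_div_n => h.
have -> : (1 - sin (x / 2) ^+ 2) *+ 2 - 1 = 1 - 2 * sin (x / 2) ^+ 2 :> R by ring.
have : (2 ^+ 2)^-1 = 4^-1 :> R by congr (_ ^-1); ring.
move: h => /[swap] ->; lra.
Qed.

Lemma dist_min_le (x y z : R) : `|Num.min x z - Num.min y z| <= `|x - y|.
Proof.
have := ler_norm (x - y); have := ler_norm (- (x - y)); rewrite normrN.
by rewrite ler_norml; case: (leP x z) => ?; case: (leP y z) => ? ? ?;
  apply/andP; split; lra.
Qed.

Section Filter.
Variables (T : Type) (F : set_system T).
Hypothesis FF : Filter F.

Lemma cvg_sumr (I : finType) (f : I -> T -> R) (l : I -> R) :
  (forall i, f i x @[x --> F] --> l i) ->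
  \sum_i f i x @[x --> F] --> \sum_i l i.
Proof. by move=> fl; apply: cvg_big => //; exact: add_continuous. Qed.

Lemma cvg_dot m (u v : T -> 'rV[R]_m) (a b : 'rV[R]_m) :
  (forall j, u x 0 j @[x --> F] --> a 0 j) ->
  (forall j, v x 0 j @[x --> F] --> b 0 j) ->
  dot (u x) (v x) @[x --> F] --> dot a b.
Proof. by move=> ua vb; apply: cvg_sumr => j; exact: cvgM. Qed.

Lemma cvg_sqrt (f : T -> R) (l : R) : f x @[x --> F] --> l ->
  Num.sqrt (f x) @[x --> F] --> Num.sqrt l.
Proof. by move=> fl; exact: (cvg_comp _ _ fl (@sqrt_continuous R l)). Qed.

Lemma cvg_entry m n (u : T -> 'M[R]_(m, n)) (a : 'M[R]_(m, n)) i j :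
  u x @[x --> F] --> a -> u x i j @[x --> F] --> a i j.
Proof. by move=> ua; exact: (cvg_comp _ _ ua (@coord_continuous _ _ _ i j a)). Qed.

Lemma cvg_radius d (n : 'I_d -> nat) (u : T -> pre_space R n) (a : pre_space R n) :
  u x @[x --> F] --> a -> Defs.radius (u x) @[x --> F] --> Defs.radius a.
Proof. move=> ua; have c : Defs.radius z @[z --> a] --> Defs.radius a by exact: cvg_fst.
exact: (cvg_comp _ _ ua c). Qed.

Lemma cvg_part_entry d (n : 'I_d -> nat) (u : T -> pre_space R n)
    (a : pre_space R n) i j :
  u x @[x --> F] --> a -> part (u x) i 0 j @[x --> F] --> part a i 0 j.
Proof.
move=> ua; have h : (u x).2 @[x --> F] --> a.2.
  have c : z.2 @[z --> a] --> a.2 by exact: cvg_snd.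
  exact: (cvg_comp _ _ ua c).
rewrite /part /submxrow !mxE.
under eq_cvg do rewrite !mxE.
exact: cvg_entry.
Qed.

End Filter.

Lemma derivable_cvg (V : normedModType R) (e : R -> V) t : derivable e t 1 ->
  (h^-1 *: (e (t + h) - e t)) @[h --> 0^'] --> derive1 e t.
Proof.
move=> de; rewrite derive1E.
have -> : (fun h => h^-1 *: (e (t + h) - e t)) =
    (fun h => h^-1 *: ((e \o shift t) (h *: 1) - e t)).
  by apply/funext => h /=; rewrite scaler1 [h + t]addrC.
exact: de.
Qed.

Lemma derivable_cvg_at (V : normedModType R) (e : R -> V) t :
  derivable e t 1 -> e s @[s --> t] --> e t.
Proof. by move=> /derivable1_diffP/differentiable_continuous. Qed.

Lemma derivable_shift_cvg (V : normedModType R) (e : R -> V) t :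
  derivable e t 1 -> e (t + h) @[h --> 0^'] --> e t.
Proof.
move=> /derivable_cvg_at ce; apply: cvg_within_filter.
have : (t + h) @[h --> 0] --> t.
  by rewrite -[X in _ --> X]addr0; apply: cvgD; [exact: cvg_cst|exact: cvg_id].
by move=> h; exact: (cvg_comp _ _ h ce).
Qed.

End Limits.

Section Calibration.
Variables (R : realType) (d : nat) (n k : 'I_d -> nat) (alpha : R).
Hypotheses (k_gt0 : forall i, (0 < k i)%N) (alpha0 : 0 < alpha).
Implicit Types (x y : pre_space R n) (A B : tensor R n k).

Local Notation radius := (@Defs.radius R d n).
Local Notation otimes := (@Defs.otimes R d n k).

(** The Euclidean coordinate, in the direction [(v, w)], of the point of the plane
   with polar coordinates [enorm A] and [alpha * fibre_dist p A].  Cutting the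
   angle at [th] does not raise the slope; it makes the value at the tensor of [q]
   independent of how much [fibre_dist] exceeds the intended angle. *)
Definition cone_coord (p : pre_space R n) (th v w : R) A : R :=
  let t := Num.min (alpha * fibre_dist p A) th in
  enorm A * (v * cos t + w * sin t).

Variables (p : pre_space R n) (th v w : R).
Hypotheses (pp : pre_segre_veronese p) (vw : v ^+ 2 + w ^+ 2 = 1).

Local Notation Phi := (cone_coord p th v w).

(** The difference of the coordinates is at most the distance between the two
   points of the plane, which the law of cosines bounds through
   [cos x >= 1 - x ^+ 2 / 2] and the Lipschitz property of [fibre_dist]. *)
Lemma cone_coord_lip A B x y : representative A x -> representative B y ->
  0 < dot A B ->
  `|Phi B - Phi A| <= Num.sqrt ((enorm B - enorm A) ^+ 2 +
    alpha ^+ 2 * (enorm A * enorm B) * ((enorm A * enorm B / dot A B) ^+ 2 - 1)).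
Proof.
move=> rx ry AB.
have fd := fibre_dist_near k_gt0 pp rx ry AB.
set z := (_ / _) ^+ 2 - 1 in fd *.
have z0 : 0 <= z.
  have [z' [_ h]] := close_representatives k_gt0 rx ry AB.
  exact: le_trans (sqr_ge0 _) h.
have rA : 0 <= enorm A by exact: sqrtr_ge0.
have rB : 0 <= enorm B by exact: sqrtr_ge0.
rewrite -sqrtr_sqr ler_wsqrtr// /cone_coord.
set s := Num.min _ _; set t := Num.min (alpha * fibre_dist p A) _.
have st : (s - t) ^+ 2 <= alpha ^+ 2 * z.
  rewrite -(real_normK (num_real (s - t))) -(sqr_sqrtr z0) -exprMn.
  rewrite lerXn2r ?nnegrE ?mulr_ge0 ?sqrtr_ge0 ?(ltW alpha0)//.
  apply: le_trans (dist_min_le _ _ _) _.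
  by rewrite -mulrBr normrM gtr0_norm// ler_pM2l.
have cst := cos_ge_quadratic (s - t).
rewrite cosB in cst.
set rb := enorm B in rB *; set ra := enorm A in rA *.
have e1 := cos2Dsin2 s; have e2 := cos2Dsin2 t.
apply: (@le_trans _ _ ((rb * cos s - ra * cos t) ^+ 2 +
                       (rb * sin s - ra * sin t) ^+ 2)).
  set X := rb * cos s - ra * cos t; set Y := rb * sin s - ra * sin t.
  have -> : rb * (v * cos s + w * sin s) - ra * (v * cos t + w * sin t) =
    v * X + w * Y by rewrite /X /Y; ring.
  rewrite -[leRHS]mul1r -vw -subr_ge0.
  have -> : (v ^+ 2 + w ^+ 2) * (X ^+ 2 + Y ^+ 2) - (v * X + w * Y) ^+ 2 =
    (v * Y - w * X) ^+ 2 by ring.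
  exact: sqr_ge0.
have -> : (rb * cos s - ra * cos t) ^+ 2 + (rb * sin s - ra * sin t) ^+ 2 =
  rb ^+ 2 * (cos s ^+ 2 + sin s ^+ 2) + ra ^+ 2 * (cos t ^+ 2 + sin t ^+ 2) -
  2 * (ra * rb) * (cos s * cos t + sin s * sin t) by ring.
rewrite e1 e2 !mulr1 sqrrB.
have ab : 0 <= ra * rb by rewrite mulr_ge0.
have c1 : 2 * (1 - (cos s * cos t + sin s * sin t)) <= alpha ^+ 2 * z by lra.
have := ler_wpM2l ab c1; lra.
Qed.

End Calibration.

(** * Calibration of the tensor manifold *)

(** The tangential part costs [alpha ^+ 2] times what remains of the squared norm
   after removing the radial part. *)
Lemma warped_metricE (R : realType) m (alpha : R) (A T : 'rV[R]_m) :
  enorm A != 0 -> warped_metric alpha A T T =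
  (dot T A / enorm A) ^+ 2 +
  alpha ^+ 2 * (dot T T - (dot T A / enorm A) ^+ 2).
Proof.
move=> rA; rewrite /warped_metric; set r := enorm A in rA *.
have AA : dot A A = r ^+ 2 by rewrite -enorm_sqr.
have xE : dot T (r^-1 *: A) = dot T A / r by rewrite dotZr mulrC.
rewrite xE; set x := dot T A / r.
have TA : dot T A = x * r by rewrite /x divfK.
rewrite scalerA dotZl dotZr dotBB !dotZl !dotZr TA AA.
by field.
Qed.

Section CalibrationTensors.
Variables (R : realType) (d : nat) (n k : 'I_d -> nat) (alpha : R).
Hypotheses (k_gt0 : forall i, (0 < k i)%N) (alpha0 : 0 < alpha).

Local Notation radius := (@Defs.radius R d n).
Local Notation otimes := (@Defs.otimes R d n k).

Variables (p : pre_space R n) (th v w : R).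
Hypotheses (pp : pre_segre_veronese p) (vw : v ^+ 2 + w ^+ 2 = 1).

Local Notation Phi := (@cone_coord R d n k alpha p th v w).

Lemma tensor_enorm_gt0 (A : tensor R n k) : segre_veronese A -> 0 < enorm A.
Proof. by move=> [x px <-]; rewrite enorm_otimes//; case: px. Qed.

Lemma continuous_warped_speed (e : R -> tensor R n k) t : derivable e t 1 ->
  {for t, continuous (derive1 e)} -> enorm (e t) != 0 ->
  {for t, continuous (speed (warped_metric alpha) e)}.
Proof.
move=> de ce r0.
have ct := derivable_cvg_at de.
have cE j : e s 0 j @[s --> t] --> e t 0 j by exact: cvg_entry.
have cD j : derive1 e s 0 j @[s --> t] --> derive1 e t 0 j by exact: cvg_entry.
have cr : (enorm (e s))^-1 @[s --> t] --> (enorm (e t))^-1.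
  by apply: cvgV => //; apply: cvg_sqrt; exact: cvg_dot.
have cr' : enorm (e s) @[s --> t] --> enorm (e t) by apply: cvg_sqrt; exact: cvg_dot.
have cW j : ((enorm (e s))^-1 *: e s) 0 j @[s --> t] -->
    ((enorm (e t))^-1 *: e t) 0 j.
  by rewrite entryZ; under eq_cvg do rewrite entryZ; exact: cvgM.
have cx : dot (derive1 e s) ((enorm (e s))^-1 *: e s) @[s --> t] -->
    dot (derive1 e t) ((enorm (e t))^-1 *: e t) by exact: cvg_dot.
apply: cvg_sqrt; apply: cvgD; first exact: cvgM.
apply: cvgM; first by apply: cvgM; apply: cvgM => //; exact: cvg_cst.
have cV j : ((enorm (e s))^-1 *: (derive1 e s -
      dot (derive1 e s) ((enorm (e s))^-1 *: e s) *: ((enorm (e s))^-1 *: e s))) 0 j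
    @[s --> t] --> ((enorm (e t))^-1 *: (derive1 e t -
      dot (derive1 e t) ((enorm (e t))^-1 *: e t) *: ((enorm (e t))^-1 *: e t))) 0 j.
  rewrite !(entryZ, entryB); under eq_cvg do rewrite !(entryZ, entryB).
  by apply: cvgM => //; apply: cvgB => //; apply: cvgM => //; exact: cvgM.
exact: cvg_dot.
Qed.

(** Along a curve, the bound of [cone_coord_lip] is [`|h|] times the square root
   of an explicit function of the difference quotient [q], whose limit is the
   squared speed. *)
Lemma cone_coord_calibrates :
  calibrates (@segre_veronese R d n k) (warped_metric alpha) Phi.
Proof.
move=> a b e ab de ce Se; split.
  apply/subspace_continuousP => t; rewrite /= in_itv/= => tab.
  apply: cvg_within_filter; apply: continuous_warped_speed => //.
  - exact: ce.
  - by rewrite gt_eqF// (tensor_enorm_gt0 (Se t tab)).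
move=> t tab.
have r0 : 0 < enorm (e t) by exact: tensor_enorm_gt0 (Se _ tab).
set r := enorm (e t) in r0.
pose q h := h^-1 *: (e (t + h) - e t).
pose r' h := enorm (e (t + h)).
pose s h := dot (e t) (e (t + h)).
pose x h := dot (q h) (e t + e (t + h)) / (r + r' h).
pose G h := x h ^+ 2 + alpha ^+ 2 * (r * r' h) *
  ((r * r' h + s h) / s h ^+ 2 * ((dot (q h) (q h) - x h ^+ 2) / 2)).
have cq j : q h 0 j @[h --> 0^'] --> derive1 e t 0 j.
  by apply: cvg_entry; exact: derivable_cvg.
have cB j : e (t + h) 0 j @[h --> 0^'] --> e t 0 j.
  by apply: cvg_entry; exact: derivable_shift_cvg.
have cs : s h @[h --> 0^'] --> r ^+ 2.
  rewrite /r enorm_sqr; apply: cvg_dot => // j; exact: cvg_cst.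
have cr : r' h @[h --> 0^'] --> r by apply: cvg_sqrt; exact: cvg_dot.
have cx : x h @[h --> 0^'] --> dot (derive1 e t) (e t + e t) / (r + r).
  apply: cvgM.
    apply: cvg_dot => // j; rewrite entryD; under eq_cvg do rewrite entryD.
    by apply: cvgD => //; exact: cvg_cst.
  apply: cvgV; first by rewrite gt_eqF// addr_gt0.
  by apply: cvgD => //; exact: cvg_cst.
have cx2 : x h ^+ 2 @[h --> 0^'] --> (dot (derive1 e t) (e t + e t) / (r + r)) ^+ 2.
  exact: cvgM.
have crr : r * r' h @[h --> 0^'] --> r * r by apply: cvgM => //; exact: cvg_cst.
have cG : G h @[h --> 0^'] --> warped_metric alpha (e t) (derive1 e t) (derive1 e t).
  rewrite warped_metricE ?gt_eqF//.
  have xE : dot (derive1 e t) (e t + e t) / (r + r) =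
    dot (derive1 e t) (e t) / r.
    by rewrite dotDr; field; rewrite ?gt_eqF ?addr_gt0.
  rewrite -/r -xE; set X := _ / (r + r) in cx2 *.
  have -> : X ^+ 2 + alpha ^+ 2 * (dot (derive1 e t) (derive1 e t) - X ^+ 2) =
    X ^+ 2 + alpha ^+ 2 * (r * r) * ((r * r + r ^+ 2) / (r ^+ 2) ^+ 2 *
      ((dot (derive1 e t) (derive1 e t) - X ^+ 2) / 2)).
    by field; rewrite gt_eqF.
  apply: cvgD => //; apply: cvgM; first by apply: cvgM => //; exact: cvg_cst.
  apply: cvgM.
    apply: cvgM; first exact: cvgD.
    by apply: cvgV; [rewrite !expf_neq0// gt_eqF|exact: cvgM].
  by apply: cvgM; [apply: cvgB => //; exact: cvg_dot|exact: cvg_cst].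
exists (fun h => Num.sqrt (G h)); first exact: cvg_sqrt.
have spos : \forall h \near 0^', 0 < s h.
  by apply: (@cvgr_gt R R _ _ s (r ^+ 2) cs); rewrite exprn_gt0.
near=> h => thab.
have h0 : h != 0 by near: h; exact: nbhs_dnbhs_neq.
have sh : 0 < s h by near: h.
have [y ry yE] := Se _ tab; have [z rz zE] := Se _ thab.
apply: le_trans (cone_coord_lip k_gt0 alpha0 th pp vw (conj ry yE) (conj rz zE) sh) _.
rewrite -sqrtr_sqr -[leRHS]sqrtrM ?sqr_ge0//.
have r'0 : 0 < r' h by exact: tensor_enorm_gt0 (Se _ thab).
have qE : e (t + h) - e t = h *: q h by rewrite /q scalerA divff// scale1r.
have dr : r' h - r = h * x h.
  rewrite /x; apply: (@mulIf _ (r + r' h)); first by rewrite gt_eqF// addr_gt0.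
  rewrite -!mulrA mulVf ?gt_eqF ?addr_gt0// mulr1 -dotZl -qE dotBl !dotDr.
  by rewrite (dotC _ (e t)) -!enorm_sqr -/r -/(r' h); ring.
have ds : r * r' h - s h = h ^+ 2 * ((dot (q h) (q h) - x h ^+ 2) / 2).
  have E : r' h ^+ 2 + r ^+ 2 - 2 * s h = h ^+ 2 * dot (q h) (q h).
    transitivity (dot (e (t + h) - e t) (e (t + h) - e t)).
      by rewrite dotBB -!enorm_sqr (dotC (e (t + h))).
    by rewrite qE dotZl dotZr mulrA expr2.
  have E2 : (r' h - r) ^+ 2 = h ^+ 2 * x h ^+ 2 by rewrite dr exprMn.
  have -> : h ^+ 2 * ((dot (q h) (q h) - x h ^+ 2) / 2) =
    (h ^+ 2 * dot (q h) (q h) - h ^+ 2 * x h ^+ 2) / 2 by ring.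
  by rewrite -E -E2; field.
rewrite -/r -/(r' h) -/(s h) dr.
have -> : (r * r' h / s h) ^+ 2 - 1 =
  (r * r' h + s h) / s h ^+ 2 * (r * r' h - s h).
  by field; rewrite gt_eqF.
rewrite ds /G le_eqVlt; apply/orP; left; apply/eqP; congr Num.sqrt.
by ring.
Unshelve. all: by end_near. Qed.

End CalibrationTensors.

(** * Calibration of the manifold of factors *)

Section CalibrationFactors.
Variables (R : realType) (d : nat) (n k : 'I_d -> nat) (alpha : R).
Hypotheses (k_gt0 : forall i, (0 < k i)%N) (alpha0 : 0 < alpha).
Implicit Types (x y z : pre_space R n).

Local Notation radius := (@Defs.radius R d n).
Local Notation otimes := (@Defs.otimes R d n k).

Lemma radiusB x y : radius (x - y) = radius x - radius y.
Proof. by []. Qed.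

Lemma radiusZ a x : radius (a *: x) = a * radius x.
Proof. by []. Qed.

Lemma partB x y i : part (x - y) i = part x i - part y i.
Proof. exact: submxrowB. Qed.

Lemma partZ a x i : part (a *: x) i = a *: part x i.
Proof. by apply/rowP => j; rewrite !mxE. Qed.

(** When points [y] and [z] with unit factors differ by [x], this is the leading
   part of the defect from one of the cosine of the angle between their tensors. *)
Definition factor_defect x : R :=
  \sum_i (k i)%:R * (dot (part x i) (part x i) / 2).

Lemma factor_defect_ge0 x : 0 <= factor_defect x.
Proof. by apply: sumr_ge0 => i _; rewrite mulr_ge0 ?divr_ge0 ?dot_ge0. Qed.

Lemma pre_metricE x y :
  pre_metric k alpha x y y =
  radius y ^+ 2 + (alpha * radius x) ^+ 2 * (2 * factor_defect y).
Proof.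
rewrite /pre_metric expr2 /factor_defect; congr (_ + _ * _).
by rewrite mulr_sumr; apply: eq_bigr => i _; field.
Qed.

Lemma dot_part_step x y q (h : R) i : pre_segre_veronese x ->
  pre_segre_veronese y -> y - x = h *: q ->
  1 - dot (part x i) (part y i) = h ^+ 2 * (dot (part q i) (part q i) / 2).
Proof.
move=> px py yx.
have : dot (part (y - x) i) (part (y - x) i) = h ^+ 2 * dot (part q i) (part q i).
  by rewrite yx partZ dotZl dotZr mulrA expr2.
rewrite partB dotBB (pre_unit _ px) (pre_unit _ py) (dotC (part y i)) => E.
by rewrite mulrA -E; field.
Qed.

Lemma factor_defect_sum x y q (h : R) : pre_segre_veronese x ->
  pre_segre_veronese y -> y - x = h *: q ->
  \sum_i (k i)%:R * (1 - dot (part x i) (part y i)) =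
  h ^+ 2 * factor_defect q.
Proof.
move=> px py yx; rewrite /factor_defect mulr_sumr; apply: eq_bigr => i _.
by rewrite (dot_part_step i px py yx) mulrCA.
Qed.

Lemma cvg_factor_defect (T : Type) (F : set_system T) {FF : Filter F}
    (u : T -> pre_space R n) x : u s @[s --> F] --> x ->
  factor_defect (u s) @[s --> F] --> factor_defect x.
Proof.
move=> ux; apply: cvg_sumr => i; apply: cvgM; first exact: cvg_cst.
apply: cvgM; last exact: cvg_cst.
by apply: cvg_dot => j; exact: cvg_part_entry.
Qed.

Lemma cvg_pre_metric (T : Type) (F : set_system T) {FF : Filter F}
    (u v : T -> pre_space R n) x y :
  u s @[s --> F] --> x -> v s @[s --> F] --> y ->
  pre_metric k alpha (u s) (v s) (v s) @[s --> F] --> pre_metric k alpha x y y.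
Proof.
move=> ux vy; rewrite pre_metricE; under eq_cvg do rewrite pre_metricE.
have vr : radius (v s) @[s --> F] --> radius y by exact: cvg_radius.
have ur : alpha * radius (u s) @[s --> F] --> alpha * radius x.
  by apply: cvgM; [exact: cvg_cst|exact: cvg_radius].
apply: cvgD; first exact: cvgM.
apply: cvgM; first exact: cvgM.
by apply: cvgM; [exact: cvg_cst|exact: cvg_factor_defect].
Qed.

Variables (p : pre_space R n) (th v w : R).
Hypotheses (pp : pre_segre_veronese p) (vw : v ^+ 2 + w ^+ 2 = 1).

Local Notation Phi := (@cone_coord R d n k alpha p th v w).

(** The cosine of the angle between the tensors is at least [m h], one minus
   [h ^+ 2] times the factor defect of the difference quotient, which turns
   [cone_coord_lip] into a bound by the metric of the factors. *)
Lemma cone_coord_otimes_calibrates :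
  calibrates (@pre_segre_veronese R d n) (pre_metric k alpha) (Phi \o otimes).
Proof.
move=> a b e ab de ce Pe; split.
  apply: continuous_subspaceT => t; apply: cvg_sqrt.
  by apply: cvg_pre_metric; [exact: derivable_cvg_at|exact: ce].
move=> t tab.
have Pt := Pe t tab.
set r := radius (e t).
have r0 : 0 < r by case: Pt.
pose q h := h^-1 *: (e (t + h) - e t).
pose r' h := radius (e (t + h)).
pose m h := 1 - h * h * factor_defect (q h).
pose G h := radius (q h) ^+ 2 + alpha ^+ 2 * (r * r' h) *
  (factor_defect (q h) * (1 + m h) / m h ^+ 2).
have cq : q h @[h --> 0^'] --> derive1 e t by exact: derivable_cvg.
have ch : h @[h --> (0 : R)^'] --> (0 : R) by apply: cvg_within_filter; exact: cvg_id.
have cf : factor_defect (q h) @[h --> 0^'] --> factor_defect (derive1 e t).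
  exact: cvg_factor_defect.
have cqr : radius (q h) @[h --> 0^'] --> radius (derive1 e t) by exact: cvg_radius.
have cs := derivable_shift_cvg (de t).
have cr : r' h @[h --> 0^'] --> r by exact: (cvg_radius cs).
have cm : m h @[h --> 0^'] --> (1 : R).
  have -> : (1 : R) = 1 - 0 * 0 * factor_defect (derive1 e t) by ring.
  apply: cvgB; first exact: cvg_cst.
  by apply: cvgM => //; exact: cvgM.
have cG : G h @[h --> 0^'] --> pre_metric k alpha (e t) (derive1 e t) (derive1 e t).
  rewrite pre_metricE -/r.
  have -> : radius (derive1 e t) ^+ 2 +
      (alpha * r) ^+ 2 * (2 * factor_defect (derive1 e t)) =
    radius (derive1 e t) ^+ 2 + alpha ^+ 2 * (r * r) *
      (factor_defect (derive1 e t) * (1 + 1) / 1 ^+ 2) by field.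
  apply: cvgD; first exact: cvgM.
  apply: cvgM.
    by apply: cvgM; [exact: cvg_cst|apply: cvgM => //; exact: cvg_cst].
  apply: cvgM; first by apply: cvgM => //; apply: cvgD => //; exact: cvg_cst.
  by apply: cvgV; [rewrite expf_neq0|exact: cvgM].
exists (fun h => Num.sqrt (G h)); first exact: cvg_sqrt.
have mpos : \forall h \near 0^', 0 < m h.
  exact: (@cvgr_gt R R _ _ m 1 cm).
near=> h => thab.
have h0 : h != 0 by near: h; exact: nbhs_dnbhs_neq.
have mh : 0 < m h by near: h.
have Ph := Pe _ thab.
have qE : e (t + h) - e t = h *: q h by rewrite /q scalerA divff// scale1r.
have r'0 : 0 < r' h by case: Ph.
set P := \prod_i dot (part (e t) i) (part (e (t + h)) i) ^+ k i.
have mP : m h <= P.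
  rewrite /m -expr2 -(factor_defect_sum Pt Ph qE); apply: prod_defect => i.
  by apply: dot_unit_bound; exact: pre_unit.
have P0 : 0 < P := lt_le_trans mh mP.
have dE : dot (otimes (e t)) (otimes (e (t + h))) = r * r' h * P.
  exact: dot_otimes.
have s0 : 0 < dot (otimes (e t)) (otimes (e (t + h))).
  by rewrite dE !mulr_gt0.
apply: le_trans (cone_coord_lip k_gt0 alpha0 th pp vw (conj Pt erefl)
  (conj Ph erefl) s0) _.
rewrite -sqrtr_sqr -[leRHS]sqrtrM ?sqr_ge0// ler_wsqrtr//.
rewrite !enorm_otimes// dE -/r -/(r' h).
have -> : r * r' h / (r * r' h * P) = P^-1.
  by rewrite invfM mulrA divff ?mul1r// mulf_neq0// gt_eqF.
have -> : r' h - r = h * radius (q h) by rewrite -radiusB qE.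
rewrite /G [leRHS]mulrDr exprMn lerD2l [leRHS]mulrCA ler_wpM2l//.
  by rewrite mulr_ge0 ?sqr_ge0// mulr_ge0 ?ltW.
have -> : h ^+ 2 * (factor_defect (q h) * (1 + m h) / m h ^+ 2) =
    (m h)^-1 ^+ 2 - 1.
  have -> : h ^+ 2 * (factor_defect (q h) * (1 + m h) / m h ^+ 2) =
    (1 - m h) * (1 + m h) / m h ^+ 2 by rewrite /m; ring.
  by field; rewrite gt_eqF.
by rewrite lerD2r lerXn2r ?nnegrE ?invr_ge0 ?(ltW mh) ?(ltW P0)// lef_pV2 ?posrE.
Unshelve. all: by end_near. Qed.

End CalibrationFactors.

(** * Segments in polar coordinates *)

Section Chord.
Variable R : realType.

(** [(rho, th)] is, in polar coordinates, the segment traversed at constant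
   speed from the point [(la, 0)] to the point [(mu, Th)]. *)
Record polar_chord (la mu Th : R) (rho rho' th th' : R -> R) : Prop :=
  PolarChord {
  chord_derive_rho : forall t : R, is_derive t 1 rho (rho' t);
  chord_derive_th : forall t : R, is_derive t 1 th (th' t);
  chord_continuous_rho : continuous rho';
  chord_continuous_th : continuous th';
  chord_gt0 : forall t, 0 <= t <= 1 -> 0 < rho t;
  chord_rho0 : rho 0 = la;
  chord_rho1 : rho 1 = mu;
  chord_th0 : th 0 = 0;
  chord_th1 : th 1 = Th;
  chord_speed : forall t, rho' t ^+ 2 + (rho t * th' t) ^+ 2 =
    (mu * cos Th - la) ^+ 2 + (mu * sin Th) ^+ 2;
  chord_rho'0 : rho' 0 = mu * cos Th - la;
  chord_th'0 : th' 0 = mu * sin Th / la;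
  chord_radial : Th = 0 -> forall t, th' t = 0 }.

Lemma polar_chord0 (la mu : R) : 0 < la -> 0 < mu ->
  polar_chord la mu 0 (fun t => la + t * (mu - la)) (fun=> mu - la)
    (fun=> 0) (fun=> 0).
Proof.
move=> la0 mu0; split.
- by move=> t; apply: is_derive_eq; rewrite /GRing.scale /=; ring.
- by move=> t; exact: is_derive_cst.
- by move=> t; exact: cvg_cst.
- by move=> t; exact: cvg_cst.
- move=> t /andP[t0 t1].
  have [->|tN1] := eqVneq t 1; first by rewrite mul1r addrC subrK.
  have t1' : 0 < 1 - t by rewrite subr_gt0 lt_neqAle tN1.
  have -> : la + t * (mu - la) = (1 - t) * la + t * mu by ring.
  by rewrite ltr_wpDr ?mulr_gt0// mulr_ge0// ltW.
- by rewrite mul0r addr0.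
- by rewrite mul1r addrC subrK.
- by [].
- by [].
- by move=> t; rewrite cos0 sin0 !mulr0 mulr1.
- by rewrite cos0 mulr1.
- by rewrite sin0 mulr0 mul0r.
- by [].
Qed.

Lemma cos_atan_div (x y : R) : 0 < y ->
  cos (atan (x / y)) = y / Num.sqrt (x ^+ 2 + y ^+ 2).
Proof.
move=> y0; rewrite cos_atan.
have -> : x ^+ 2 + y ^+ 2 = y ^+ 2 * (1 + (x / y) ^+ 2).
  by field; rewrite gt_eqF.
rewrite sqrtrM ?sqr_ge0// sqrtr_sqr gtr0_norm// invfM mulrA divff ?mul1r//.
by rewrite gt_eqF.
Qed.

Lemma sin_atan_div (x y : R) : 0 < y ->
  sin (atan (x / y)) = x / Num.sqrt (x ^+ 2 + y ^+ 2).
Proof.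
move=> y0; have c0 : cos (atan (x / y)) != 0.
  by rewrite gt_eqF// cos_gt0_pihalf// atan_gtNpi2 atan_ltpi2.
have := atanK (x / y); rewrite /tan => /(congr1 (fun z => z * cos (atan (x / y)))).
rewrite divfK// => ->; rewrite cos_atan_div//.
by rewrite mulrA divfK// gt_eqF.
Qed.

(** The line through the end points of the chord stays at a positive distance
   from the origin.  With [xi] the coordinate along this line and [eta] the
   distance to it, both multiplied by the length of the chord, the polar angle
   is [atan (xi / eta)] up to a constant. *)
Lemma polar_chord_gt0 (la mu Th : R) : 0 < la -> 0 < mu -> 0 < Th < pi ->
  exists rho rho' th th', polar_chord la mu Th rho rho' th th'.
Proof.
move=> la0 mu0 Thpi.
have s0 : 0 < sin Th by exact: sin_gt0_pi.
set a := mu * cos Th - la; set b := mu * sin Th.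
have b0 : 0 < b by rewrite mulr_gt0.
pose L2 := a ^+ 2 + b ^+ 2.
have L20 : 0 < L2 by rewrite ltr_wpDl ?sqr_ge0// exprn_gt0.
pose eta := la * b.
have eta0 : 0 < eta by rewrite mulr_gt0.
pose xi t := la * a + t * L2.
pose sq t := (la + t * a) ^+ 2 + (t * b) ^+ 2.
have sqE t : xi t ^+ 2 + eta ^+ 2 = L2 * sq t by rewrite /xi /eta /sq /L2; ring.
have sq0 t : 0 < sq t.
  by rewrite -(pmulr_rgt0 _ L20) -sqE ltr_wpDl ?sqr_ge0// exprn_gt0.
pose rho t := Num.sqrt (sq t).
have rho0 t : 0 < rho t by rewrite sqrtr_gt0.
have rho2 t : rho t ^+ 2 = sq t by rewrite sqr_sqrtr// ltW.
pose rho' t := xi t / rho t.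
pose th t := atan (xi t / eta) - atan (xi 0 / eta).
pose th' t := eta / sq t.
have dxi (t : R) : is_derive t 1 xi L2.
  by apply: is_derive_eq; rewrite /GRing.scale /=; ring.
have dsq (t : R) : is_derive t 1 sq (2 * xi t).
  by apply: is_derive_eq; rewrite /GRing.scale /= /xi /L2; ring.
have drho (t : R) : is_derive t 1 rho (rho' t).
  have h := is_derive1_comp (is_derive1_sqrt (sq0 t)) (dsq t).
  apply: (is_derive_eq h); rewrite /rho' -/(rho t).
  by field; rewrite gt_eqF.
have dth (t : R) : is_derive t 1 th (th' t).
  have h0 : is_derive t 1 (fun s => xi s / eta) (L2 / eta).
    have -> : (fun s => xi s / eta) = xi * cst eta^-1 by [].
    have := @is_deriveM _ _ xi (cst eta^-1) t 1 _ _ (dxi t) (is_derive_cst _ _ _).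
    by move=> h; apply: (is_derive_eq h); rewrite /GRing.scale /=; ring.
  have h := @is_derive1_comp R atan (fun s => xi s / eta) t _ _
    (is_derive1_atan (xi t / eta)) h0.
  have h2 := is_deriveB h (is_derive_cst (atan (xi 0 / eta)) t 1).
  apply: (is_derive_eq h2); rewrite subr0 /th'.
  have -> : sq t = (xi t ^+ 2 + eta ^+ 2) / L2.
    by rewrite sqE mulrAC divff ?mul1r// gt_eqF.
  have e1 : 1 + (xi t / eta) ^+ 2 = (xi t ^+ 2 + eta ^+ 2) / eta ^+ 2.
    by field; rewrite gt_eqF.
  have e2 : 0 < xi t ^+ 2 + eta ^+ 2 by rewrite sqE mulr_gt0.
  by rewrite e1; field; rewrite !gt_eqF.
have cxi : continuous xi.
  by move=> t; apply: derivable_cvg_at; case: (dxi t).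
have csq : continuous sq.
  by move=> t; apply: derivable_cvg_at; case: (dsq t).
have crho : continuous rho.
  by move=> t; apply: derivable_cvg_at; case: (drho t).
exists rho, rho', th, th'; split=> //.
- move=> t; apply: cvgM; first exact: cxi.
  by apply: cvgV; [rewrite gt_eqF|exact: crho].
- move=> t; apply: cvgM; first exact: cvg_cst.
  by apply: cvgV; [rewrite gt_eqF|exact: csq].
- by rewrite /rho /sq !mul0r addr0 expr0n addr0 sqrtr_sqr gtr0_norm.
- rewrite /rho /sq !mul1r /a [la + _]addrC subrK /b !exprMn -mulrDr cos2Dsin2.
  by rewrite mulr1 sqrtr_sqr gtr0_norm.
- by rewrite /th subrr.
- have xi1 : xi 1 = mu * (cos Th * a + sin Th * b).
    rewrite /xi mul1r /L2 /a /b; ring.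
  have xi0 : xi 0 = la * a by rewrite /xi mul0r addr0.
  have rho1 : rho 1 = mu.
    rewrite /rho /sq !mul1r /a [la + _]addrC subrK /b !exprMn -mulrDr cos2Dsin2.
    by rewrite mulr1 sqrtr_sqr gtr0_norm.
  have rho00 : rho 0 = la.
    by rewrite /rho /sq !mul0r addr0 expr0n addr0 sqrtr_sqr gtr0_norm.
  have lt10 : atan (xi 0 / eta) < atan (xi 1 / eta).
    apply: lt_atan; rewrite ltr_pM2r ?invr_gt0//.
    by rewrite /xi mul0r addr0 mul1r ltrDl.
  have th1I : th 1 \in `[0, pi].
    rewrite in_itv/= /th subr_ge0 (ltW lt10)/=.
    have := atan_ltpi2 (xi 1 / eta); have := atan_gtNpi2 (xi 0 / eta); lra.
  have ThI : Th \in `[0, pi].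
    by case/andP: Thpi => h1 h2; rewrite in_itv/= !ltW.
  apply: cos_inj => //.
  rewrite /th cosB !cos_atan_div// !sin_atan_div// !sqE.
  rewrite !sqrtrM ?(ltW L20)// -/(rho 1) -/(rho 0) rho1 rho00.
  set l := Num.sqrt L2.
  have l0 : 0 < l by rewrite sqrtr_gt0.
  have l2 : l ^+ 2 = L2 by rewrite sqr_sqrtr// ltW.
  apply: (@mulIf _ (l ^+ 2)); first by rewrite gt_eqF// exprn_gt0.
  rewrite [in RHS]l2 xi0 xi1 /eta.
  transitivity ((la * b * (la * b) + mu * (cos Th * a + sin Th * b) * (la * a)) /
     (mu * la)); first by field; rewrite !gt_eqF.
  rewrite /L2 {2}/b /a; have -> : la * b = la * mu * sin Th by rewrite /b mulrA.
  rewrite /b; field; rewrite !gt_eqF//.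
- move=> t; rewrite /rho' /th'.
  have -> : (xi t / rho t) ^+ 2 + (rho t * (eta / sq t)) ^+ 2 =
    (xi t ^+ 2 + eta ^+ 2) / sq t.
    by rewrite -rho2; field; rewrite gt_eqF.
  by rewrite sqE mulfK ?gt_eqF.
- have -> : rho' 0 = la * a / la.
    rewrite /rho' /xi mul0r addr0 /rho /sq !mul0r addr0 expr0n addr0 sqrtr_sqr.
    by rewrite gtr0_norm.
  by rewrite mulrAC divff ?mul1r// gt_eqF.
- rewrite /th' /sq /eta !mul0r addr0 expr0n addr0 -/b.
  by field; rewrite gt_eqF.
- by move=> Th0; move: Thpi; rewrite Th0 ltxx.
Qed.

Lemma polar_chord_exists (la mu Th : R) : 0 < la -> 0 < mu -> 0 <= Th < pi ->
  exists rho rho' th th', polar_chord la mu Th rho rho' th th'.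
Proof.
move=> la0 mu0 /andP[]; rewrite le_eqVlt => /predU1P[<- _|Th0 Thpi].
  exists (fun t => la + t * (mu - la)), (fun=> mu - la), (fun=> 0), (fun=> 0).
  exact: polar_chord0.
by apply: polar_chord_gt0; rewrite // Th0.
Qed.

Lemma unit_direction (a b : R) : exists v w : R, v ^+ 2 + w ^+ 2 = 1 /\
  v * a + w * b = Num.sqrt (a ^+ 2 + b ^+ 2).
Proof.
set L := Num.sqrt _.
have L2 : L ^+ 2 = a ^+ 2 + b ^+ 2 by rewrite sqr_sqrtr// addr_ge0// sqr_ge0.
have [L0|L0] := eqVneq L 0.
  exists 1, 0; rewrite L0 expr1n expr0n addr0 mul1r mul0r addr0; split=> //.
  have : a ^+ 2 + b ^+ 2 = 0 by rewrite -L2 L0 expr0n.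
  by move/eqP; rewrite paddr_eq0 ?sqr_ge0// sqrf_eq0 => /andP[/eqP].
exists (a / L), (b / L); split.
  have -> : (a / L) ^+ 2 + (b / L) ^+ 2 = (a ^+ 2 + b ^+ 2) / L ^+ 2 by field.
  by rewrite L2 divff// -L2 sqrf_eq0.
have -> : a / L * a + b / L * b = (a ^+ 2 + b ^+ 2) / L by field.
by rewrite -L2 expr2 mulfK.
Qed.

End Chord.

(** * Continuously differentiable curves *)

Section CurvesC1.
Variables (R : realType).

Lemma is_derive_of_cvg (V : normedModType R) (e : R -> V) (t : R) (l : V) :
  (h^-1 *: (e (t + h) - e t)) @[h --> 0^'] --> l -> is_derive t 1 e l.
Proof.
have -> : (fun h => h^-1 *: (e (t + h) - e t)) =
    (fun h => h^-1 *: ((e \o shift t) (h *: 1) - e t)).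
  by apply/funext => h /=; rewrite scaler1 [h + t]addrC.
move=> el; split; first by apply/cvg_ex; exists l.
exact: cvg_lim el.
Qed.

Lemma is_derive_cvg (V : normedModType R) (e : R -> V) (t : R) (l : V) :
  is_derive t 1 e l -> (h^-1 *: (e (t + h) - e t)) @[h --> 0^'] --> l.
Proof.
by move=> [de <-]; rewrite -derive1E; exact: derivable_cvg.
Qed.

Lemma is_derive_comp_diff (V W : normedModType R) (f : R -> V) (g : V -> W)
    (t : R) (v : V) : is_derive t 1 f v -> differentiable g (f t) ->
  is_derive t 1 (g \o f) ('d g (f t) v).
Proof.
move=> [df <-] dg; have df' : differentiable f t by exact/derivable1_diffP.
have dgf : differentiable (g \o f) t by exact: differentiable_comp.
split; first exact/derivable1_diffP.
by rewrite !deriveE// diff_comp.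
Qed.

Definition C1_with (V : normedModType R) (f f' : R -> V) :=
  (forall t : R, is_derive t 1 f (f' t)) /\ continuous f'.

Lemma C1_with_derive1 (V : normedModType R) (f f' : R -> V) :
  C1_with f f' -> derive1 f = f'.
Proof.
by move=> [df _]; apply/funext => t; rewrite derive1E; case: (df t).
Qed.

Lemma C1_with_on (V : normedModType R) (f f' : R -> V) (a b : R) :
  C1_with f f' -> C1_on a b f.
Proof.
move=> h; exists f; split=> //; first by move=> t; case: (h.1 t).
by rewrite (C1_with_derive1 h); exact: h.2.
Qed.

Lemma C1_with_continuous (V : normedModType R) (f f' : R -> V) :
  C1_with f f' -> continuous f.
Proof. by move=> [df _] t; apply: derivable_cvg_at; case: (df t). Qed.

Lemma C1_with_initial_velocity (V : normedModType R) (f f' : R -> V) :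
  C1_with f f' -> initial_velocity f (f' 0).
Proof.
move=> [df _]; apply: cvg_dnbhs_at_right.
have := is_derive_cvg (df 0).
by under eq_cvg do rewrite add0r.
Qed.

Lemma C1_with_cst (V : normedModType R) (v : V) : C1_with (fun=> v) (fun=> 0).
Proof. by split=> t; [exact: is_derive_cst|exact: cvg_cst]. Qed.

Lemma C1_withM (f f' g g' : R -> R) : C1_with f f' -> C1_with g g' ->
  C1_with (fun t => f t * g t) (fun t => f t * g' t + g t * f' t).
Proof.
move=> hf hg; split=> t.
  have := @is_deriveM _ _ f g t 1 _ _ (hf.1 t) (hg.1 t).
  by move=> h; apply: (is_derive_eq h).
apply: cvgD; apply: cvgM;
  by [exact: C1_with_continuous hf t|exact: C1_with_continuous hg t
     |exact: hf.2|exact: hg.2].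
Qed.

Lemma C1_with_cos (f f' : R -> R) : C1_with f f' ->
  C1_with (fun t => cos (f t)) (fun t => - sin (f t) * f' t).
Proof.
move=> hf; split=> t.
  exact: (@is_derive1_comp R cos f t _ _ (is_derive_cos _) (hf.1 t)).
apply: cvgM; last exact: hf.2.
apply: cvgN; have cf := C1_with_continuous hf.
exact: (cvg_comp _ _ (cf t) (@continuous_sin R (f t))).
Qed.

Lemma C1_with_sin (f f' : R -> R) : C1_with f f' ->
  C1_with (fun t => sin (f t)) (fun t => cos (f t) * f' t).
Proof.
move=> hf; split=> t.
  exact: (@is_derive1_comp R sin f t _ _ (is_derive_sin _) (hf.1 t)).
apply: cvgM; last exact: hf.2.
have cf := C1_with_continuous hf.
exact: (cvg_comp _ _ (cf t) (@continuous_cos R (f t))).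
Qed.

Lemma C1_withD (f f' g g' : R -> R) : C1_with f f' -> C1_with g g' ->
  C1_with (fun t => f t + g t) (fun t => f' t + g' t).
Proof.
move=> hf hg; split=> t.
  exact: (@is_deriveD _ _ _ f g t 1 _ _ (hf.1 t) (hg.1 t)).
by apply: cvgD; [exact: hf.2|exact: hg.2].
Qed.

Lemma C1_with_prod (I : finType) (f : I -> R -> R) :
  (forall i, exists f', C1_with (f i) f') ->
  exists f', C1_with (fun t => \prod_i f i t) f'.
Proof.
move=> hf.
suff h (s : seq I) : exists f', C1_with (fun t => \prod_(i <- s) f i t) f'.
  exact: h.
elim: s => [|i s [g' hg]].
  exists (fun=> 0); under eq_fun do rewrite big_nil.
  exact: C1_with_cst.
have [f' hf'] := hf i; eexists.
under eq_fun do rewrite big_cons.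
exact: C1_withM hf' hg.
Qed.

Lemma C1_withZ (V : normedModType R) (f f' : R -> R) (v : V) : C1_with f f' ->
  C1_with (fun t => f t *: v) (fun t => f' t *: v).
Proof.
move=> [df cf]; split=> t; last by apply: cvgZ; [exact: cf|exact: cvg_cst].
apply: is_derive_of_cvg.
have h : (h^-1 *: (f (t + h) - f t)) *: v @[h --> 0^'] --> f' t *: v.
  by apply: cvgZ; [exact: is_derive_cvg|exact: cvg_cst].
by under eq_cvg do rewrite -scalerBl scalerA.
Qed.

Lemma C1_with_sum (V : normedModType R) (I : finType) (f f' : I -> R -> V) :
  (forall i, C1_with (f i) (f' i)) ->
  C1_with (fun t => \sum_i f i t) (fun t => \sum_i f' i t).
Proof.
move=> hf; split=> t; last first.
  by apply: cvg_big => [|i _]; [exact: add_continuous|exact: (hf i).2].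
apply: is_derive_of_cvg.
under eq_cvg do rewrite -sumrB scaler_sumr.
apply: cvg_big => [|i _]; first exact: add_continuous.
by apply: is_derive_cvg; exact: (hf i).1.
Qed.

Lemma C1_with_row (m : nat) (f f' : R -> 'rV[R]_m) :
  (forall j, C1_with (fun t => f t 0 j) (fun t => f' t 0 j)) -> C1_with f f'.
Proof.
move=> hf.
have -> : f = fun t => \sum_j f t 0 j *: delta_mx 0 j.
  by apply/funext => t; exact: row_sum_delta.
have -> : f' = fun t => \sum_j f' t 0 j *: delta_mx 0 j.
  by apply/funext => t; exact: row_sum_delta.
by apply: C1_with_sum => j; exact: C1_withZ.
Qed.

Lemma C1_with_entry (m : nat) (f f' : R -> 'rV[R]_m) j : C1_with f f' ->
  C1_with (fun t => f t 0 j) (fun t => f' t 0 j).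
Proof.
move=> [df cf]; split=> t; last by apply: cvg_entry; exact: cf.
apply: is_derive_of_cvg.
have h : (h^-1 *: (f (t + h) - f t)) 0 j @[h --> 0^'] --> f' t 0 j.
  by apply: cvg_entry; exact: is_derive_cvg.
by move: h; under eq_cvg do rewrite entryZ entryB.
Qed.

Lemma C1_with_pair (V W : normedModType R) (f f' : R -> V) (g g' : R -> W) :
  C1_with f f' -> C1_with g g' ->
  C1_with (fun t => (f t, g t)) (fun t => (f' t, g' t)).
Proof.
move=> [df cf] [dg cg]; split=> t; last by apply: cvg_pair; [exact: cf|exact: cg].
by apply: is_derive_of_cvg; apply: cvg_pair; exact: is_derive_cvg.
Qed.

End CurvesC1.

(** * The differential of the tensor map *)

Section TensorMap.
Variables (R : realType) (d : nat) (n k : 'I_d -> nat) (alpha : R).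
Hypothesis k_gt0 : forall i, (0 < k i)%N.
Implicit Types (x y : pre_space R n).

Local Notation radius := (@Defs.radius R d n).
Local Notation otimes := (@Defs.otimes R d n k).

Lemma differentiable_radius x : differentiable radius x.
Proof.
have -> : radius = fst by [].
by apply: linear_differentiable => z; exact: cvg_fst.
Qed.

Lemma differentiable_part_entry x i j :
  differentiable (fun z : pre_space R n => part z i 0 j) x.
Proof.
have -> : (fun z : pre_space R n => part z i 0 j) =
    (fun u : 'rV[R]_(\sum_i n i) => u 0 (tagnat.Rank i j)) \o snd.
  by apply/funext => z; rewrite /part /submxrow !mxE.
apply: differentiable_comp; last exact: differentiable_coord.
by apply: linear_differentiable => z; exact: cvg_snd.
Qed.

Lemma differentiable_prod (V : normedModType R) (I : finType) (f : I -> V -> R)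
    (x : V) : (forall i, differentiable (f i) x) ->
  differentiable (fun z => \prod_i f i z) x.
Proof.
move=> df.
suff h (s : seq I) : differentiable (fun z => \prod_(i <- s) f i z) x.
  exact: h.
elim: s => [|i s IH].
  under eq_fun do rewrite big_nil.
  exact: differentiable_cst.
under eq_fun do rewrite big_cons.
exact: (@differentiableM _ _ (f i)).
Qed.

Lemma differentiable_otimes x : differentiable otimes x.
Proof.
have -> : otimes = \sum_j (fun z => otimes z 0 j *: delta_mx 0 j).
  by apply/funext => z; rewrite fct_sumE; exact: row_sum_delta.
apply: differentiable_sum => j.
apply: (@differentiableZl _ _ _ (fun z => otimes z 0 j)).
under eq_fun do rewrite mxE.
apply: (@differentiableM _ _ radius); first exact: differentiable_radius.
apply: (@differentiable_prod _ _ (fun i z => \prod_l part z i 0 _)) => i.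
apply: (@differentiable_prod _ _ (fun l z => part z i 0 _)) => l.
exact: differentiable_part_entry.
Qed.

Lemma C1_with_otimes (e e' : R -> pre_space R n) :
  C1_with (fun t => radius (e t)) (fun t => radius (e' t)) ->
  (forall i j, exists f, C1_with (fun t => part (e t) i 0 j) f) ->
  exists f, C1_with (otimes \o e) f.
Proof.
move=> hr hp.
have entry j : {f | C1_with (fun t => otimes (e t) 0 j) f}.
  apply: cid.
  have [f hf] : exists f, C1_with (fun t => \prod_(i < d) \prod_(l < k i)
      part (e t) i 0 ((enum_val j : multi_index n k) i l)) f.
    by apply: C1_with_prod => i; apply: C1_with_prod => l; exact: hp.
  eexists; under eq_fun do rewrite mxE.
  exact: C1_withM hr hf.
exists (fun t => \row_j sval (entry j) t).
apply: C1_with_row => j.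
by under [X in C1_with _ X]eq_fun do rewrite mxE; exact: svalP (entry j).
Qed.

(** The squared norm of the derivative [T] is computed without expanding it, as the
   limit of squared difference quotients.  These involve the product [P] of the
   powers of the cosines between factors, and with [S] the sum of the defects of
   these cosines, [1 - S <= P <= expR (- S)], hence [P <= (1 + S)^-1]. *)
Lemma otimes_isometry (e : R -> pre_space R n) (t : R) (v : pre_space R n)
    (T : tensor R n k) : is_derive t 1 e v -> is_derive t 1 (otimes \o e) T ->
  (\forall s \near t, pre_segre_veronese (e s)) ->
  warped_metric alpha (otimes (e t)) T T = pre_metric k alpha (e t) v v.
Proof.
move=> dv dT Pe.
have Pt : pre_segre_veronese (e t) := nbhs_singleton Pe.
set r := radius (e t).
have r0 : 0 < r by case: Pt.
pose q h := h^-1 *: (e (t + h) - e t).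
pose qT h := h^-1 *: (otimes (e (t + h)) - otimes (e t)).
pose r' h := radius (e (t + h)).
pose D h := factor_defect k (q h).
have cq : q h @[h --> 0^'] --> v by exact: is_derive_cvg.
have cqT j : qT h 0 j @[h --> 0^'] --> T 0 j.
  by apply: cvg_entry; exact: (is_derive_cvg dT).
have de : derivable e t 1 by case: dv.
have cs := derivable_shift_cvg de.
have cr : r' h @[h --> 0^'] --> r by exact: (cvg_radius cs).
have cD : D h @[h --> 0^'] --> factor_defect k v by exact: cvg_factor_defect.
have cqr : radius (q h) @[h --> 0^'] --> radius v by exact: cvg_radius.
have ch : h @[h --> (0 : R)^'] --> (0 : R) by apply: cvg_within_filter; exact: cvg_id.
have chD : h * h * D h @[h --> 0^'] --> (0 : R).
  have e0 : 0 * 0 * factor_defect k v = 0 by rewrite !mul0r.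
  by rewrite -[X in _ --> X]e0; apply: cvgM => //; exact: cvgM.
have nearP : \forall h \near 0^', pre_segre_veronese (e (t + h)).
  have ct : (t + h) @[h --> (0 : R)^'] --> t.
    by rewrite -[X in _ --> X]addr0; apply: cvgD => //; exact: cvg_cst.
  exact: (ct _ Pe).
have cdTT : dot (qT h) (qT h) @[h --> 0^'] --> dot T T by exact: cvg_dot.
have cTT : dot (qT h) (qT h) @[h --> 0^'] -->
    radius v ^+ 2 + r * r * (2 * factor_defect k v).
  pose lo h := radius (q h) ^+ 2 + r * r' h * (2 * (D h / (1 + h * h * D h))).
  pose up h := radius (q h) ^+ 2 + r * r' h * (2 * D h).
  have crr : r * r' h @[h --> 0^'] --> r * r by apply: cvgM => //; exact: cvg_cst.
  have cup : up h @[h --> 0^'] --> radius v ^+ 2 + r * r * (2 * factor_defect k v).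
    apply: cvgD; first exact: cvgM.
    by apply: cvgM => //; apply: cvgM => //; exact: cvg_cst.
  have clo : lo h @[h --> 0^'] --> radius v ^+ 2 + r * r * (2 * factor_defect k v).
    have -> : factor_defect k v = factor_defect k v / (1 + 0).
      by rewrite addr0 divr1.
    apply: cvgD; first exact: cvgM.
    apply: cvgM => //; apply: cvgM; first exact: cvg_cst.
    apply: cvgM => //; apply: cvgV; first by rewrite addr0.
    by apply: cvgD => //; exact: cvg_cst.
  have small : \forall h \near 0^', h * h * D h < 1.
    exact: (@cvgr_lt R R _ _ (fun h => h * h * D h) 0 chD).
  apply: squeeze_cvgr clo cup; near=> h.
  have h0 : h != 0 by near: h; exact: nbhs_dnbhs_neq.
  have Ph : pre_segre_veronese (e (t + h)) by near: h.
  have hD : h * h * D h < 1 by near: h.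
  have D0 : 0 <= D h by exact: factor_defect_ge0.
  have r'0 : 0 < r' h by case: Ph.
  have qE : e (t + h) - e t = h *: q h by rewrite /q scalerA divff// scale1r.
  pose c i := dot (part (e t) i) (part (e (t + h)) i).
  set P := \prod_i c i ^+ k i.
  have cE : \sum_i (k i)%:R * (1 - c i) = h ^+ 2 * D h.
    exact: (factor_defect_sum k Pt Ph qE).
  have c1 i : -1 <= c i <= 1 by apply: dot_unit_bound; exact: pre_unit.
  have P1 : 1 - h ^+ 2 * D h <= P by rewrite -cE; exact: prod_defect.
  have P2 : (1 + h ^+ 2 * D h) * P <= 1.
    have c0 i : 0 <= c i.
      have : (k i)%:R * (1 - c i) < 1.
        rewrite expr2 in cE; apply: le_lt_trans hD; rewrite -cE (bigD1 i)//=.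
        rewrite lerDl sumr_ge0// => j _.
        by rewrite mulr_ge0// subr_ge0; case/andP: (c1 j).
      have : 1 - c i <= (k i)%:R * (1 - c i).
        by rewrite ler_peMl ?ler1n// subr_ge0; case/andP: (c1 i).
      lra.
    have P3 : P <= expR (- (h ^+ 2 * D h)) by rewrite -cE; exact: prod_le_expR.
    apply: (@le_trans _ _ (expR (h ^+ 2 * D h) * expR (- (h ^+ 2 * D h)))).
      apply: ler_pM => //; [|by apply: prodr_ge0 => i _; exact: exprn_ge0|].
        by rewrite addr_ge0// mulr_ge0// sqr_ge0.
      exact: expR_ge1Dx.
    by rewrite -expRD subrr expR0.
  have E : h ^+ 2 * dot (qT h) (qT h) =
      h ^+ 2 * radius (q h) ^+ 2 + r * r' h * (2 * (1 - P)).
    have E1 : dot (otimes (e (t + h)) - otimes (e t))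
        (otimes (e (t + h)) - otimes (e t)) = h ^+ 2 * dot (qT h) (qT h).
      by rewrite /qT dotZl dotZr; field.
    have E2 : h * radius (q h) = r' h - r by rewrite -radiusZ -qE radiusB.
    rewrite -E1 -exprMn E2 dotBB !dot_otimesxx// (dotC (otimes (e (t + h)))).
    rewrite dot_otimes -/r -/(r' h) -/P; ring.
  have h2 : 0 < h ^+ 2 by rewrite exprn_even_gt0.
  have hD0 : 0 <= h ^+ 2 * D h by rewrite mulr_ge0// ltW.
  have -> : dot (qT h) (qT h) =
      radius (q h) ^+ 2 + r * r' h * (2 * ((1 - P) / h ^+ 2)).
    by apply: (mulfI (lt0r_neq0 h2)); rewrite E; field.
  have rr0 : 0 < r * r' h by rewrite mulr_gt0.
  rewrite /lo /up !lerD2l !(ler_pM2l rr0) !ler_pM2l// -expr2.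
  rewrite ler_pdivlMr// ler_pdivrMr// [D h / _ * _]mulrAC ler_pdivrMr.
    by rewrite [D h * _]mulrC; apply/andP; split; lra.
  by rewrite ltr_wpDr.
have TT : dot T T = radius v ^+ 2 + r * r * (2 * factor_defect k v).
  exact: (cvg_unique _ cdTT cTT).
(* The squared norm of [otimes (e s)] is [radius (e s) ^+ 2]; both are now
   differentiated. *)
have TA : dot T (otimes (e t)) = radius v * r.
  have c1 : dot (qT h) (otimes (e (t + h)) + otimes (e t)) @[h --> 0^'] -->
      dot T (otimes (e t) + otimes (e t)).
    apply: cvg_dot => // j; rewrite entryD; under eq_cvg do rewrite entryD.
    apply: cvgD; last exact: cvg_cst.
    have dTt : derivable (otimes \o e) t 1 by case: dT.
    by apply: cvg_entry; exact: (derivable_shift_cvg dTt).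
  have c2 : dot (qT h) (otimes (e (t + h)) + otimes (e t)) @[h --> 0^'] -->
      radius v * (r + r).
    have c3 : radius (q h) * (r' h + r) @[h --> 0^'] --> radius v * (r + r).
      by apply: cvgM => //; apply: cvgD => //; exact: cvg_cst.
    apply: cvg_trans c3; apply: near_eq_cvg; near=> h.
    have h0 : h != 0 by near: h; exact: nbhs_dnbhs_neq.
    have Ph : pre_segre_veronese (e (t + h)) by near: h.
    rewrite /qT dotZl dotBl !dotDr (dotC (otimes (e t))) !dot_otimesxx//.
    by rewrite /q radiusZ radiusB -/r -/(r' h); ring.
  have : dot T (otimes (e t)) + dot T (otimes (e t)) = radius v * (r + r).
    by rewrite -dotDr; exact: (cvg_unique _ c1 c2).
  lra.
rewrite warped_metricE; last by rewrite enorm_otimes// gt_eqF.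
rewrite enorm_otimes// TT TA pre_metricE -/r mulfK ?gt_eqF//; ring.
Unshelve. all: by end_near. Qed.

End TensorMap.

(** * The geodesic *)

Section GreatCircles.
Variables (R : realType) (m : nat).
Implicit Types u v : 'rV[R]_m.

(** The unit tangent vector at [u] towards [v] when [u] and [v] are independent. *)
Definition direction u v : 'rV[R]_m := (angle u v)^-1 *: sphere_log u v.

Definition great_circle u v (s : R) : 'rV[R]_m :=
  cos (angle u v * s) *: u + sin (angle u v * s) *: direction u v.

(** For [u = v] the direction is [0] and not a unit vector, but then it only occurs
   with a factor [sin 0] or [angle u v = 0]. *)
Lemma direction_spec u v : dot u u = 1 -> dot v v = 1 -> u <> - v ->
  [/\ dot u (direction u v) = 0,
      angle u v = 0 \/ dot (direction u v) (direction u v) = 1,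
      great_circle u v 1 = v &
      angle u v *: direction u v = sphere_log u v].
Proof.
move=> u1 v1 uNv; rewrite /great_circle mulr1 /direction /sphere_log.
have [uv|/eqP uv] := eqVneq u v.
  have -> : angle u v = 0 by rewrite -uv /angle u1 acos1.
  rewrite scaler0 dot0r cos0 sin0 !scale0r scale1r addr0.
  by split=> //; left.
have vu1 : dot v u <> 1 by move=> h; apply: uv; apply: dot_eq1 => //; rewrite dotC.
have vuN1 : dot v u <> -1.
  move=> h; apply: uNv; apply: dot_eq1 => //; first by rewrite dotNl dotNr opprK.
  by rewrite dotNr dotC h opprK.
have := cos_angle u1 v1; set f := angle u v => cf.
have ss : sin f ^+ 2 = 1 - dot v u ^+ 2 by rewrite sin2cos2 cf dotC.
have s0 : sin f != 0.
  rewrite -sqrf_eq0 ss subr_eq0 eq_sym sqrf_eq1.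
  by apply/norP; split; apply/eqP.
have f0 : f != 0 by apply: contraNneq s0 => ->; rewrite sin0.
have dE : f^-1 *: ((f / sin f) *: (v - dot v u *: u)) =
    (sin f)^-1 *: (v - dot v u *: u).
  by rewrite scalerA mulrA mulVf// mul1r.
rewrite dE; split.
- by rewrite dotZr dotBr dotZr u1 mulr1 (dotC u v) subrr mulr0.
- right; rewrite dotZl dotZr dotBB !dotZl !dotZr u1 v1.
  have -> : 1 + dot v u * (dot v u * 1) - 2 * (dot v u * dot v u) = sin f ^+ 2.
    by rewrite ss; ring.
  by field.
- by rewrite scalerA divff// scale1r cf (dotC u v) addrC subrK.
- by rewrite scalerA.
Qed.

Lemma great_circle_unit u v s : dot u u = 1 -> dot v v = 1 -> u <> - v ->
  dot (great_circle u v s) (great_circle u v s) = 1.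
Proof.
move=> u1 v1 uNv; have [uw ww _ _] := direction_spec u1 v1 uNv.
rewrite /great_circle; move: (direction u v) uw ww => w uw ww.
rewrite dotDl !dotDr !dotZl !dotZr u1 (dotC w u) uw.
rewrite !mulr0 addr0 add0r mulr1 -expr2 -[RHS](cos2Dsin2 (angle u v * s)).
congr (_ + _); case: ww => [->|->]; last by rewrite mulr1 expr2.
by rewrite mul0r sin0 !mul0r expr0n.
Qed.

Definition great_circle_velocity u v (s : R) : 'rV[R]_m :=
  angle u v *: (cos (angle u v * s) *: direction u v - sin (angle u v * s) *: u).

Lemma great_circle_speed u v s : dot u u = 1 -> dot v v = 1 -> u <> - v ->
  dot (great_circle_velocity u v s) (great_circle_velocity u v s) =
  angle u v ^+ 2.
Proof.
move=> u1 v1 uNv; have [uw ww _ _] := direction_spec u1 v1 uNv.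
rewrite /great_circle_velocity; move: (direction u v) uw ww => w uw ww.
rewrite dotZl dotZr.
case: ww => [->|ww]; first by rewrite !mul0r expr0n.
rewrite dotBB !dotZl !dotZr u1 (dotC w u) uw ww !mulr0 subr0 !mulr1 -!expr2.
by rewrite cos2Dsin2 mulr1 expr2.
Qed.

End GreatCircles.

Section Geodesic.
Variables (R : realType) (d : nat) (n k : 'I_d -> nat) (alpha : R).
Hypotheses (k_gt0 : forall i, (0 < k i)%N) (alpha0 : 0 < alpha).
Variables (p q : pre_space R n).
Hypotheses (Pp : pre_segre_veronese p) (Pq : pre_segre_veronese q).
Hypothesis pNq : forall i, part p i <> - part q i.

Local Notation radius := (@Defs.radius R d n).
Local Notation otimes := (@Defs.otimes R d n k).
Local Notation M := (Mdist k p q).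
Local Notation Th := (alpha * M).

Variables rho rho' th th' : R -> R.
Hypothesis chord : polar_chord (radius p) (radius q) Th rho rho' th th'.

(** When [Th = 0] all the great circles are constant, so that the quotient
   [th t / Th] may take any value. *)
Definition geodesic (t : R) : pre_space R n :=
  (rho t, \mxrow_i great_circle (part p i) (part q i) (th t / Th)).

Definition geodesic_velocity (t : R) : pre_space R n :=
  (rho' t, \mxrow_i ((th' t / Th) *:
     great_circle_velocity (part p i) (part q i) (th t / Th))).

Lemma part_geodesic t i :
  part (geodesic t) i = great_circle (part p i) (part q i) (th t / Th).
Proof. by rewrite /part mxrowK. Qed.

Lemma part_geodesic_velocity t i : part (geodesic_velocity t) i =
  (th' t / Th) *: great_circle_velocity (part p i) (part q i) (th t / Th).
Proof. by rewrite /part mxrowK. Qed.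

Lemma C1_with_great_circle (m : nat) (u v : 'rV[R]_m) : C1_with
  (fun t => great_circle u v (th t / Th))
  (fun t => (th' t / Th) *: great_circle_velocity u v (th t / Th)).
Proof.
apply: C1_with_row => j.
have hth : C1_with th th'.
  by split; [exact: chord_derive_th chord|exact: chord_continuous_th chord].
have hs := C1_withM (C1_with_cst (angle u v)) (C1_withM hth (C1_with_cst Th^-1)).
have := C1_withD (C1_withM (C1_with_cos hs) (C1_with_cst (u 0 j)))
  (C1_withM (C1_with_sin hs) (C1_with_cst (direction u v 0 j))).
congr C1_with; apply/funext => t; rewrite !mxE//=.
by ring.
Qed.

Lemma C1_with_geodesic : C1_with geodesic geodesic_velocity.
Proof.
apply: C1_with_pair.
  by split; [exact: chord_derive_rho chord|exact: chord_continuous_rho chord].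
apply: C1_with_row => j.
have := C1_with_great_circle (part p (tagnat.sig1 j)) (part q (tagnat.sig1 j)).
move=> /(C1_with_entry (tagnat.sig2 j)).
by congr C1_with; apply/funext => t; rewrite [RHS]mxE.
Qed.

Lemma geodesic_pre t : 0 <= t <= 1 -> pre_segre_veronese (geodesic t).
Proof.
move=> t01; split; first exact: chord_gt0 chord _ t01.
by move=> i; apply/enorm1E; rewrite part_geodesic great_circle_unit ?pre_unit.
Qed.

Lemma geodesic_start : geodesic 0 = p.
Proof.
apply: pre_eq => [|i]; first exact: chord_rho0 chord.
rewrite part_geodesic (chord_th0 chord) mul0r /great_circle mulr0 cos0 sin0.
by rewrite scale1r scale0r addr0.
Qed.

Lemma angle_eq0 i : M = 0 -> angle (part p i) (part q i) = 0.
Proof.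
move=> /eqP; rewrite sqrtr_eq0 => M0.
have : \sum_i (k i)%:R * angle (part p i) (part q i) ^+ 2 = 0.
  by apply/eqP; rewrite eq_le M0 Mdist_sum_ge0.
move=> /psumr_eq0P => /(_ (fun i _ => mulr_ge0 (ler0n _ _) (sqr_ge0 _)) i isT).
move=> /eqP; rewrite mulf_eq0 pnatr_eq0 sqrf_eq0 gtn_eqF//=.
by move/eqP.
Qed.

Lemma geodesic_end : geodesic 1 = q.
Proof.
apply: pre_eq => [|i]; first exact: chord_rho1 chord.
have [_ _ e _] := direction_spec (pre_unit i Pp) (pre_unit i Pq) (@pNq i).
rewrite part_geodesic (chord_th1 chord) -[RHS]e /great_circle.
have [M0|M0] := eqVneq M 0; first by rewrite angle_eq0// !mul0r.
by rewrite divff// mulf_neq0// gt_eqF.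
Qed.

Lemma geodesic_speed t :
  pre_metric k alpha (geodesic t) (geodesic_velocity t) (geodesic_velocity t) =
  (radius q * cos Th - radius p) ^+ 2 + (radius q * sin Th) ^+ 2.
Proof.
rewrite -(chord_speed chord t) pre_metricE; congr (_ + _).
have -> : 2 * factor_defect k (geodesic_velocity t) = (th' t / Th) ^+ 2 * M ^+ 2.
  rewrite sqr_sqrtr ?Mdist_sum_ge0// /factor_defect !mulr_sumr.
  apply: eq_bigr => i _; rewrite part_geodesic_velocity dotZl dotZr.
  rewrite (great_circle_speed _ (pre_unit i Pp) (pre_unit i Pq) (@pNq i)).
  by move: (th' t / Th) => z; field.
have [M0|M0] := eqVneq M 0.
  by rewrite (chord_radial chord) ?M0 ?mulr0// mul0r expr0n mul0r !mulr0.
change (radius (geodesic t)) with (rho t).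
by field; rewrite M0 gt_eqF.
Qed.

Lemma geodesic_velocity_start : geodesic_velocity 0 = pre_log k alpha p q.
Proof.
have vE i : great_circle_velocity (part p i) (part q i) 0 =
    sphere_log (part p i) (part q i).
  have [_ _ _ <-] := direction_spec (pre_unit i Pp) (pre_unit i Pq) (@pNq i).
  by rewrite /great_circle_velocity mulr0 cos0 sin0 scale1r scale0r subr0.
rewrite /pre_log /geodesic_velocity (chord_th0 chord) mul0r.
rewrite (chord_rho'0 chord) (chord_th'0 chord).
have [M0|M0] := eqVneq M 0.
  rewrite M0 mulr0 cos0 mulr1; congr (_, _).
  apply/mxrowP => i; rewrite mxrowK submxrow0 invr0 mulr0 scale0r//.
congr (_, _); apply/mxrowP => i; rewrite !mxrowK vE; congr (_ *: _).
by rewrite -mulrA -invfM mulrA.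
Qed.

Local Notation L := (Num.sqrt ((radius q * cos Th - radius p) ^+ 2 +
  (radius q * sin Th) ^+ 2)).

Lemma speed_geodesic t : speed (pre_metric k alpha) geodesic t = L.
Proof.
by rewrite /speed (C1_with_derive1 C1_with_geodesic) geodesic_speed.
Qed.

Lemma C1_with_tensor_geodesic : exists f, C1_with (otimes \o geodesic) f.
Proof.
apply: (@C1_with_otimes R d n k geodesic geodesic_velocity) => [|i j].
  by split; [exact: chord_derive_rho chord|exact: chord_continuous_rho chord].
eexists; under eq_fun do rewrite part_geodesic.
exact: C1_with_entry (C1_with_great_circle _ _).
Qed.

Lemma speed_tensor_geodesic t : 0 < t < 1 ->
  speed (warped_metric alpha) (otimes \o geodesic) t = L.
Proof.
move=> /andP[t0 t1]; have [f hf] := C1_with_tensor_geodesic.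
have Pe : \forall s \near t, pre_segre_veronese (geodesic s).
  near=> s; apply: geodesic_pre; apply/andP; split.
  - by near: s; exact: lt_le_nbhsr.
  - by near: s; exact: lt_le_nbhsl.
have iso := otimes_isometry alpha k_gt0 (C1_with_geodesic.1 t) (hf.1 t) Pe.
by rewrite /speed (C1_with_derive1 hf) -(geodesic_speed t) -iso.
Unshelve. all: by end_near. Qed.

Lemma tensor_geodesic_velocity :
  initial_velocity (otimes \o geodesic) ('d otimes p (pre_log k alpha p q)).
Proof.
have [f hf] := C1_with_tensor_geodesic.
suff <- : f 0 = 'd otimes p (pre_log k alpha p q) by exact: C1_with_initial_velocity.
have h : is_derive (0 : R) 1 (otimes \o geodesic)
    ('d otimes (geodesic 0) (geodesic_velocity 0)).
  by apply: is_derive_comp_diff (C1_with_geodesic.1 0) _; exact: differentiable_otimes.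
rewrite geodesic_start geodesic_velocity_start in h.
by have [_ <-] := hf.1 0; have [_ <-] := h.
Qed.

Variables v w : R.

Lemma cone_coord_start : cone_coord alpha p Th v w (otimes p) = radius p * v.
Proof.
have rp : representative (otimes p) p by [].
have f0 : fibre_dist p (otimes p) = 0.
  apply/eqP; rewrite eq_le (fibre_dist_ge0 p rp) andbT.
  by rewrite -[leRHS](Mdistxx k Pp) fibre_dist_le.
have Th0 : 0 <= Th by rewrite mulr_ge0 ?Mdist_ge0 ?ltW.
by rewrite /cone_coord f0 enorm_otimes// mulr0 min_l// cos0 sin0 mulr1 mulr0 addr0.
Qed.

Lemma cone_coord_end :
  (forall q', representative (otimes q) q' -> M <= Mdist k p q') ->
  cone_coord alpha p Th v w (otimes q) = radius q * (v * cos Th + w * sin Th).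
Proof.
move=> Mmin; have rq : representative (otimes q) q by [].
have fM : M <= fibre_dist p (otimes q) by exact: le_fibre_dist rq Mmin.
by rewrite /cone_coord enorm_otimes// min_r// ler_wpM2l// ltW.
Qed.

End Geodesic.

(** * The logarithm *)

Theorem theorem4p10 (R : realType) (d : nat) (n k : 'I_d -> nat) (alpha : R)
    (hd : (0 < d)%N) (hn : forall i, (0 < n i)%N) (hk : forall i, (0 < k i)%N)
    (halpha : 0 < alpha)
    (P Q : tensor R n k) (hP : segre_veronese P) (hQ : segre_veronese Q)
    (p q : pre_space R n)
    (hmatched : matched P Q p q)
    (hcompatible : compatible k alpha p q)
    (hantipodal : forall i, part p i <> - part q i) :
  is_log (@pre_segre_veronese R d n) (pre_metric k alpha) p q
    (pre_log k alpha p q) /\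
  is_log (@segre_veronese R d n k) (warped_metric alpha) P Q
    ('d (otimes k) p (pre_log k alpha p q)).
Proof.
have [[Pp <-] [Pq <-] Mmin] := hmatched.
have rp : representative (otimes k p) p by [].
have {}Mmin q' : representative (otimes k q) q' -> Mdist k p q <= Mdist k p q'.
  exact: Mmin.
have ThI : 0 <= alpha * Mdist k p q < pi.
  by rewrite mulr_ge0 ?Mdist_ge0 ?ltW//= mulrC -ltr_pdivlMr.
have [rho [rho' [th [th' chord]]]] := polar_chord_exists Pp.1 Pq.1 ThI.
have [v [w [vw vwL]]] := unit_direction
  (Defs.radius q * cos (alpha * Mdist k p q) - Defs.radius p)
  (Defs.radius q * sin (alpha * Mdist k p q)).
set c := geodesic k alpha p q rho th.
have c0 : c 0 = p by exact: geodesic_start chord.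
have c1 : c 1 = q by exact: (geodesic_end hk halpha Pp Pq hantipodal chord).
have cP t : 0 <= t <= 1 -> pre_segre_veronese (c t).
  exact: (geodesic_pre Pp Pq hantipodal chord).
have cC := C1_with_geodesic chord.
have gain : Num.sqrt
    ((Defs.radius q * cos (alpha * Mdist k p q) - Defs.radius p) ^+ 2 +
     (Defs.radius q * sin (alpha * Mdist k p q)) ^+ 2) <=
    cone_coord alpha p (alpha * Mdist k p q) v w (otimes k q) -
    cone_coord alpha p (alpha * Mdist k p q) v w (otimes k p).
  rewrite (cone_coord_end halpha Pq v w Mmin) (cone_coord_start k halpha q Pp v w).
  rewrite -vwL; lra.
split.
- exists c; split; last first.
    rewrite -(geodesic_velocity_start Pp Pq hantipodal chord).
    exact: C1_with_initial_velocity.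
  apply: (minimizing_of_calibrates
    (cone_coord_otimes_calibrates hk halpha (alpha * Mdist k p q) Pp vw)) gain.
  + exact: C1_with_on cC.
  + by split.
  + by move=> t _; exact: (speed_geodesic halpha Pp Pq hantipodal chord).
- exists (otimes k \o c); split; last first.
    exact: (tensor_geodesic_velocity Pp Pq hantipodal chord).
  apply: (minimizing_of_calibrates
    (cone_coord_calibrates hk halpha (alpha * Mdist k p q) Pp vw)) gain.
  + have [f hf] := C1_with_tensor_geodesic chord.
    exact: C1_with_on hf.
  + by split=> [t t01||] /=; [exists (c t); [exact: cP|]|rewrite c0|rewrite c1].
  + move=> t t01; exact: (speed_tensor_geodesic hk halpha Pp Pq hantipodal chord).
Qed.
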